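(* Let $\beta\ge1$ and let $\varphi\in\mathcal{S}(\mathbb{R})$ satisfy $\varphi(x)>0$ for all $x$ and the exponential-type decay condition of order $\beta$. If $T_1,T_2\in\mathcal{S}'(\mathbb{R})$ satisfy $\langle T_1,x^n\varphi\rangle=\langle T_2,x^n\varphi\rangle$ for all $n\ge0$, then $T_1=T_2$.
   Context: $\mathcal{S}(\mathbb{R})$, $\mathcal{S}'(\mathbb{R})$ denote Schwartz functions and tempered distributions. For $\beta\ge1$, a function $\varphi\in\mathcal{S}(\mathbb{R})$ satisfies an exponential-type decay condition of order $\beta$ if there exist $A>0$ and, for each $m\ge0$, a constant $C_m>0$ such that $$\sup_{x\in\mathbb{R}}(1+|x|)^k\,|\varphi^{(m)}(x)|\le C_m\,A^k\,(k!)^{1/\beta}\qquad\text{for all integers }k,m\ge0.$$ *)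

(* Defs.v *)
From Stdlib Require Import Reals Factorial Lra Lia ProofIrrelevance FunctionalExtensionality.
From Coquelicot Require Export Coquelicot.
Open Scope R_scope.

Definition smooth (f : R -> C) : Prop :=
  forall (m : nat) (x : R),
    ex_derive_n (fun t => Re (f t)) m x /\ ex_derive_n (fun t => Im (f t)) m x.

(* Coquelicot's [Derive_n] is only for real-valued functions; the derivative
    of a complex-valued function of a real variable is componentwise. *)
Definition CDerive_n (f : R -> C) (m : nat) (x : R) : C :=
  (Derive_n (fun t => Re (f t)) m x, Derive_n (fun t => Im (f t)) m x).

(* The weights [(1 + |x|)^k] give the same space and topology as [|x|^k]. *)
Definition seminorm (k m : nat) (f : R -> C) : Rbar :=
  Lub_Rbar (fun y => exists x : R, y = (1 + Rabs x) ^ k * Cmod (CDerive_n f m x)).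

Definition is_schwartz (f : R -> C) : Prop :=
  smooth f /\ forall k m : nat, Rbar_lt (seminorm k m f) p_infty.

Record schwartz : Type := Schwartz {
  schwartz_fun :> R -> C;
  schwartz_prop : is_schwartz schwartz_fun
}.

Lemma schwartz_eq (f g : schwartz) : (forall x, f x = g x) -> f = g.
Proof.
destruct f as [f pf], g as [g pg]; simpl; intros H.
apply functional_extensionality in H; subst g.
now rewrite (proof_irrelevance _ pf pg).
Qed.

Definition is_rschwartz (u : R -> R) : Prop :=
  (forall m x, ex_derive_n u m x) /\
  forall k m, exists M, forall x, (1 + Rabs x) ^ k * Rabs (Derive_n u m x) <= M.

Lemma weight_pos k x : 0 < (1 + Rabs x) ^ k.
Proof. apply pow_lt; generalize (Rabs_pos x); lra. Qed.

Lemma seminorm_le k m f M :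
  (forall x, (1 + Rabs x) ^ k * Cmod (CDerive_n f m x) <= M) <->
  Rbar_le (seminorm k m f) M.
Proof.
destruct (Lub_Rbar_correct
  (fun y => exists x : R, y = (1 + Rabs x) ^ k * Cmod (CDerive_n f m x)))
  as [Hub Hlub].
split; intros H.
- apply Hlub; intros y [x ->]; apply H.
- intros x.
  apply (Rbar_le_trans (Finite _) (seminorm k m f) (Finite M)); [|exact H].
  apply Hub; now exists x.
Qed.

Lemma seminorm_finite k m f :
  (exists M, forall x, (1 + Rabs x) ^ k * Cmod (CDerive_n f m x) <= M) <->
  Rbar_lt (seminorm k m f) p_infty.
Proof.
split.
- intros [M H]; apply seminorm_le in H.
  now destruct (seminorm k m f).
- destruct (seminorm k m f) as [M| |] eqn:E; intros H.
  + exists M; apply seminorm_le; rewrite E; apply Rle_refl.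
  + elim H.
  + exists 0; apply seminorm_le; rewrite E; exact I.
Qed.

Lemma is_schwartzE f :
  is_schwartz f <->
  is_rschwartz (fun t => Re (f t)) /\ is_rschwartz (fun t => Im (f t)).
Proof.
split.
- intros [Hs Hb]; split; (split; [intros m x; apply Hs|]);
    intros k m; destruct (proj2 (seminorm_finite k m f) (Hb k m)) as [M H];
    exists M; intros x; (eapply Rle_trans; [|apply (H x)]);
    apply Rmult_le_compat_l; try (apply Rlt_le, weight_pos);
    (eapply Rle_trans; [|apply Rmax_Cmod]); simpl; [apply Rmax_l|apply Rmax_r].
- intros [[Hu Bu] [Hv Bv]]; split; [now split|].
  intros k m; apply seminorm_finite.
  destruct (Bu k m) as [M HM], (Bv k m) as [N HN].
  exists (sqrt 2 * Rmax M N); intros x.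
  assert (Hw := weight_pos k x).
  assert (H2 := sqrt_pos 2).
  eapply Rle_trans.
  { apply Rmult_le_compat_l; [now apply Rlt_le|apply Cmod_2Rmax]. }
  rewrite <- Rmult_assoc, (Rmult_comm _ (sqrt 2)), Rmult_assoc.
  apply Rmult_le_compat_l; [exact H2|]; simpl.
  rewrite <- RmaxRmult by now apply Rlt_le.
  apply Rmax_lub; (eapply Rle_trans; [apply HM || apply HN|]);
    [apply Rmax_l|apply Rmax_r].
Qed.

Lemma is_rschwartz_ext u v :
  (forall x, u x = v x) -> is_rschwartz u -> is_rschwartz v.
Proof. intros H; apply functional_extensionality in H; now subst. Qed.

Lemma is_rschwartz_plus u v :
  is_rschwartz u -> is_rschwartz v -> is_rschwartz (fun x => u x + v x).
Proof.
intros [Hu Bu] [Hv Bv]; split.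
- intros m x; apply ex_derive_n_plus; now apply filter_forall.
- intros k m; destruct (Bu k m) as [M HM], (Bv k m) as [N HN].
  exists (M + N); intros x.
  rewrite Derive_n_plus by now apply filter_forall.
  specialize (HM x); specialize (HN x).
  assert (H := Rabs_triang (Derive_n u m x) (Derive_n v m x)).
  assert (Hw := weight_pos k x); nra.
Qed.

Lemma is_rschwartz_scal a u :
  is_rschwartz u -> is_rschwartz (fun x => a * u x).
Proof.
intros [Hu Bu]; split.
- intros m x; now apply ex_derive_n_scal_l.
- intros k m; destruct (Bu k m) as [M HM].
  exists (Rabs a * M); intros x.
  rewrite Derive_n_scal_l, Rabs_mult.
  specialize (HM x); assert (Ha := Rabs_pos a); nra.
Qed.

Lemma Derive_n_mulx u :
  (forall m x, ex_derive_n u m x) ->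
  forall m x, Derive_n (fun t => t * u t) m x =
    x * Derive_n u m x + INR m * Derive_n u (pred m) x.
Proof.
intros Hu m; induction m as [|m IH]; intros x.
- simpl; ring.
- cbn [Derive_n]; rewrite (Derive_ext _ _ x IH).
  assert (D1 : ex_derive (Derive_n u m) x) by exact (Hu (S m) x).
  assert (E : INR m * Derive (Derive_n u (pred m)) x = INR m * Derive_n u m x).
  { destruct m as [|m]; [simpl; ring|reflexivity]. }
  assert (D2 : ex_derive (fun t => INR m * Derive_n u (pred m) t) x).
  { apply (ex_derive_scal (Derive_n u (pred m))), (Hu (S (pred m)) x). }
  rewrite Derive_plus; [|now apply (ex_derive_mult (fun t => t));
                         [apply ex_derive_id|]|exact D2].
  rewrite (Derive_mult (fun t => t)), Derive_id, Derive_scal, E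
    by (apply ex_derive_id || exact D1).
  rewrite S_INR; cbn [pred Derive_n]; ring.
Qed.

Lemma is_rschwartz_mulx u :
  is_rschwartz u -> is_rschwartz (fun x => x * u x).
Proof.
intros [Hu Bu]; split.
- intros [|m] x; [exact I|].
  cbn [ex_derive_n].
  apply ex_derive_ext with
    (fun t => t * Derive_n u m t + INR m * Derive_n u (pred m) t).
  { intros t; now rewrite Derive_n_mulx. }
  apply @ex_derive_plus.
  + apply (ex_derive_mult (fun t => t)); [apply ex_derive_id|exact (Hu (S m) x)].
  + apply (ex_derive_scal (Derive_n u (pred m))), (Hu (S (pred m)) x).
- intros k m.
  destruct (Bu (S k) m) as [M HM], (Bu k (pred m)) as [N HN].
  exists (M + INR m * N); intros x.
  rewrite Derive_n_mulx by exact Hu.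
  specialize (HM x); specialize (HN x); simpl in HM.
  assert (Hw := weight_pos k x); assert (Hm := pos_INR m).
  set (a := Derive_n u m x) in *; set (b := Derive_n u (pred m) x) in *.
  assert (H : Rabs (x * a + INR m * b)
              <= (1 + Rabs x) * Rabs a + INR m * Rabs b).
  { eapply Rle_trans; [apply Rabs_triang|].
    rewrite !Rabs_mult, (Rabs_pos_eq (INR m)) by exact Hm.
    generalize (Rabs_pos a); nra. }
  set (w := (1 + Rabs x) ^ k) in *.
  eapply Rle_trans; [apply Rmult_le_compat_l; [now apply Rlt_le|exact H]|].
  nra.
Qed.

Lemma is_schwartz_zero : is_schwartz (fun _ => zero).
Proof.
assert (Z : is_rschwartz (fun _ => 0)).
{ assert (E : forall m x, Derive_n (fun _ => 0) m x = 0).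
  { intros [|m] x; [reflexivity|exact (Derive_n_const m 0 x)]. }
  split; [intros; apply ex_derive_n_const|].
  intros k m; exists 0; intros x; rewrite E, Rabs_R0; lra. }
apply is_schwartzE; now split.
Qed.

Lemma is_schwartz_plus f g :
  is_schwartz f -> is_schwartz g -> is_schwartz (fun x => plus (f x) (g x)).
Proof.
intros Hf Hg; apply is_schwartzE in Hf, Hg; apply is_schwartzE.
split; now apply is_rschwartz_plus.
Qed.

Lemma is_schwartz_scal (c : C) f :
  is_schwartz f -> is_schwartz (fun x => scal c (f x)).
Proof.
intros Hf; apply is_schwartzE in Hf; destruct Hf as [Hu Hv].
apply is_schwartzE; split.
- apply is_rschwartz_ext with (fun x => fst c * Re (f x) + - snd c * Im (f x)).
  { intros x; unfold Re, Im; simpl; ring. }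
  now apply is_rschwartz_plus; apply is_rschwartz_scal.
- apply is_rschwartz_ext with (fun x => fst c * Im (f x) + snd c * Re (f x)).
  { intros x; unfold Re, Im; simpl; ring. }
  now apply is_rschwartz_plus; apply is_rschwartz_scal.
Qed.

Lemma is_schwartz_opp f : is_schwartz f -> is_schwartz (fun x => opp (f x)).
Proof.
intros Hf; apply (is_schwartz_scal (opp one)) in Hf.
replace (fun x => opp (f x)) with (fun x => scal (opp one) (f x)); [exact Hf|].
apply functional_extensionality; intros x; apply injective_projections; simpl; ring.
Qed.

Lemma is_schwartz_mul_pow n f :
  is_schwartz f -> is_schwartz (fun x => Cmult (RtoC (x ^ n)) (f x)).
Proof.
intros Hf; apply is_schwartzE in Hf; destruct Hf as [Hu Hv].
assert (P : forall u, is_rschwartz u -> is_rschwartz (fun x => x ^ n * u x)).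
{ clear; intros u Hu; induction n as [|n IH].
  - apply is_rschwartz_ext with u; [intros x; simpl; ring|exact Hu].
  - apply is_rschwartz_ext with (fun x => x * (x ^ n * u x)).
    { intros x; simpl; ring. }
    now apply is_rschwartz_mulx. }
apply is_schwartzE; split.
- apply is_rschwartz_ext with (fun x => x ^ n * Re (f x)); [|now apply P].
  intros x; unfold Re, Im; simpl; ring.
- apply is_rschwartz_ext with (fun x => x ^ n * Im (f x)); [|now apply P].
  intros x; unfold Re, Im; simpl; ring.
Qed.

Definition schwartz_zero : schwartz := Schwartz _ is_schwartz_zero.

Definition schwartz_plus (f g : schwartz) : schwartz :=
  Schwartz _ (is_schwartz_plus f g (schwartz_prop f) (schwartz_prop g)).

Definition schwartz_opp (f : schwartz) : schwartz :=
  Schwartz _ (is_schwartz_opp f (schwartz_prop f)).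

Definition schwartz_scal (c : C) (f : schwartz) : schwartz :=
  Schwartz _ (is_schwartz_scal c f (schwartz_prop f)).

Definition schwartz_AbelianMonoid_mixin : AbelianMonoid.mixin_of schwartz.
Proof.
apply (AbelianMonoid.Mixin schwartz schwartz_plus schwartz_zero);
  intros; apply schwartz_eq; intros t; simpl.
- apply plus_comm.
- apply plus_assoc.
- apply plus_zero_r.
Defined.

Canonical schwartz_AbelianMonoid :=
  AbelianMonoid.Pack schwartz schwartz_AbelianMonoid_mixin schwartz.

Definition schwartz_AbelianGroup_mixin :
  AbelianGroup.mixin_of schwartz_AbelianMonoid.
Proof.
apply (AbelianGroup.Mixin schwartz_AbelianMonoid schwartz_opp).
intros f; apply schwartz_eq; intros t; exact (plus_opp_r (f t)).
Defined.

Canonical schwartz_AbelianGroup :=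
  AbelianGroup.Pack schwartz
    (AbelianGroup.Class _ _ schwartz_AbelianGroup_mixin) schwartz.

Definition schwartz_ModuleSpace_mixin :
  ModuleSpace.mixin_of C_Ring schwartz_AbelianGroup.
Proof.
apply (ModuleSpace.Mixin C_Ring schwartz_AbelianGroup schwartz_scal);
  intros; apply schwartz_eq; intros t.
- exact (scal_assoc x y (u t)).
- exact (scal_one (u t)).
- exact (scal_distr_l x (u t) (v t)).
- exact (scal_distr_r x y (u t)).
Defined.

Canonical schwartz_ModuleSpace :=
  ModuleSpace.Pack C_Ring schwartz
    (ModuleSpace.Class _ _ _ schwartz_ModuleSpace_mixin) schwartz.

Definition mul_pow (n : nat) (f : schwartz) : schwartz :=
  Schwartz _ (is_schwartz_mul_pow n f (schwartz_prop f)).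

(* Neighbourhood filter of [f] for the locally convex topology generated by
    the family of all [seminorm k m]. *)
Definition schwartz_locally (f : schwartz) (P : schwartz -> Prop) : Prop :=
  exists (N : nat) (eps : posreal), forall g : schwartz,
    (forall k m : nat, (k <= N)%nat -> (m <= N)%nat ->
      Rbar_lt (seminorm k m (minus g f)) eps) ->
    P g.

Record tempered_distribution : Type := TemperedDistribution {
  td_fun :> schwartz -> C;
  td_plus : forall f g : schwartz,
    td_fun (plus f g) = Cplus (td_fun f) (td_fun g);
  td_scal : forall (c : C) (f : schwartz),
    td_fun (scal c f) = Cmult c (td_fun f);
  td_continuous : forall f : schwartz,
    filterlim td_fun (schwartz_locally f) (locally (td_fun f))
}.

Definition exp_type_decay (beta : R) (phi : schwartz) : Prop :=
  exists (A : R) (Cst : nat -> R),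
    0 < A /\ (forall m : nat, 0 < Cst m) /\
    forall k m : nat,
      Rbar_le (seminorm k m phi)
        (Cst m * A ^ k * Rpower (INR (fact k)) (1 / beta)).

(* Main.v *)
(** Put T = T1 - T2 and let W be the set of real functions u with factorial decay
    such that T kills x^n u for all n; it contains phi. For |xi| small compared with
    the decay rate, the Taylor series of cos (xi x) u and sin (xi x) u converge in the
    Schwartz space, so W is stable under multiplication by cos (xi x) and sin (xi x),
    first for small xi and then, by the addition formulas, for all xi. Hence W contains
    phi * (h * K) where h * K is the convolution of a compactly supported h with the
    trigonometric polynomial K (t) = cos (pi t / 2L)^(2n). For large L and n,
    after normalization, h * K is close to h on [-L/2, L/2] together with its derivatives
    and bounded elsewhere, so T (phi h) = 0. Given a Schwartz function g, this
    applies to h = chi g / phi for a cutoff chi. As T is controlled by finitely many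
    seminorms at a time, chi only needs to be of class C^N. *)
Require Import Defs.
From Stdlib Require Import Reals Factorial Lra Lia ProofIrrelevance FunctionalExtensionality.
From Coquelicot Require Import Coquelicot.
Open Scope R_scope.

(** * Functions of class C^n *)

(** Growth like [k!] is what makes the Taylor series of a trigonometric factor behave like a
    geometric series, hence the restriction to small frequencies. Larger ones can be reached in
    steps because a factor [cos (xi x)] or [sin (xi x)] changes only the constants of the decay,
    never its rate [A], so the allowed step does not shrink. Powers of the cosine serve as kernels
    because they are nonnegative trigonometric polynomials with explicit estimates: the mass over a
    period is at least of order [1 / n], while away from the peak the kernel decreases geometrically
    in [n]. A periodic function repeats the values of [h] and cannot be uniformly close to it on the
    whole line. Errors are therefore measured against [eps * (1 + |x|)]: far out, a mere bound
    suffices once the period is long, and the additional factor [1 + |x|] is absorbed by the decay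
    of [phi]. The error of the cutoff is measured in the same way and absorbed by the decay of
    [g]. *)

Fixpoint Ck (n : nat) (f : R -> R) : Prop :=
  match n with
  | O => forall x, continuous f x
  | S n => (forall x, ex_derive f x) /\ Ck n (Derive f)
  end.

Lemma Ck_continuous n f : Ck n f -> forall x, continuous f x.
Proof.
destruct n as [|n]; [trivial|].
intros [H _] x; apply (ex_derive_continuous f), H.
Qed.

Lemma Ck_pred n f : Ck (S n) f -> Ck n f.
Proof.
revert f; induction n as [|n IH]; intros f H.
- exact (Ck_continuous 1 f H).
- destruct H as [H1 H2]; split; [exact H1|now apply IH].
Qed.

Lemma Ck_le n m f : (m <= n)%nat -> Ck n f -> Ck m f.
Proof. induction 1; [trivial|]; intros H1; apply IHle, Ck_pred, H1. Qed.

Lemma Ck_const n c : Ck n (fun _ => c).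
Proof.
revert c; induction n as [|n IH]; intros c.
- intros x; apply continuous_const.
- split; [intros x; apply ex_derive_const|].
  replace (Derive (fun _ : R => c)) with (fun _ : R => 0); [apply IH|].
  apply functional_extensionality; intros x; now rewrite Derive_const.
Qed.

Lemma Ck_id n : Ck n (fun x => x).
Proof.
destruct n as [|n].
- intros x; apply continuous_id.
- split; [intros x; apply ex_derive_id|].
  replace (Derive (fun x : R => x)) with (fun _ : R => 1); [apply Ck_const|].
  apply functional_extensionality; intros x; now rewrite Derive_id.
Qed.

Lemma Derive_fun_plus (f g : R -> R) :
  (forall x, ex_derive f x) -> (forall x, ex_derive g x) ->
  Derive (fun x => f x + g x) = (fun x => Derive f x + Derive g x).
Proof.
intros; apply functional_extensionality; intros x.
now rewrite Derive_plus.
Qed.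

Lemma Derive_fun_mult (f g : R -> R) :
  (forall x, ex_derive f x) -> (forall x, ex_derive g x) ->
  Derive (fun x => f x * g x) = (fun x => Derive f x * g x + f x * Derive g x).
Proof.
intros; apply functional_extensionality; intros x.
now rewrite Derive_mult.
Qed.

Lemma Ck_plus n f g : Ck n f -> Ck n g -> Ck n (fun x => f x + g x).
Proof.
revert f g; induction n as [|n IH]; intros f g Hf Hg.
- intros x; apply (continuous_plus f g); [apply Hf|apply Hg].
- destruct Hf as [Hf1 Hf2], Hg as [Hg1 Hg2]; split.
  + intros x; now apply (ex_derive_plus f g).
  + rewrite Derive_fun_plus by assumption; now apply IH.
Qed.

Lemma Ck_mult n f g : Ck n f -> Ck n g -> Ck n (fun x => f x * g x).
Proof.
revert f g; induction n as [|n IH]; intros f g Hf Hg.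
- intros x; apply (continuous_mult f g); [apply Hf|apply Hg].
- assert (Hf0 := Ck_pred _ _ Hf); assert (Hg0 := Ck_pred _ _ Hg).
  destruct Hf as [Hf1 Hf2], Hg as [Hg1 Hg2]; split.
  + intros x; now apply (ex_derive_mult f g).
  + rewrite Derive_fun_mult by assumption; now apply Ck_plus; apply IH.
Qed.

Lemma Ck_minus n f g : Ck n f -> Ck n g -> Ck n (fun x => f x - g x).
Proof.
intros Hf Hg.
replace (fun x => f x - g x) with (fun x => f x + -1 * g x)
  by (apply functional_extensionality; intros; ring).
apply Ck_plus; [exact Hf|].
apply (Ck_mult n (fun _ => -1)); [apply Ck_const|exact Hg].
Qed.

Lemma Ck_pow n f k : Ck n f -> Ck n (fun x => f x ^ k).
Proof.
intros Hf; induction k as [|k IH]; simpl; [apply Ck_const|now apply Ck_mult].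
Qed.

Lemma Ck_comp n f q : Ck n f -> Ck n q -> Ck n (fun x => f (q x)).
Proof.
revert f q; induction n as [|n IH]; intros f q Hf Hq.
- intros x; apply (continuous_comp q f); [apply Hq|apply Hf].
- assert (Hq0 := Ck_pred _ _ Hq).
  destruct Hf as [Hf1 Hf2], Hq as [Hq1 Hq2]; split.
  + intros x; now apply (ex_derive_comp f q).
  + replace (Derive (fun x => f (q x))) with
      (fun x => Derive q x * Derive f (q x)).
    * apply Ck_mult; [exact Hq2|now apply IH].
    * apply functional_extensionality; intros x; symmetry.
      now apply (Derive_comp f q).
Qed.

Lemma Ck_inv n f : (forall x, f x <> 0) -> Ck n f -> Ck n (fun x => / f x).
Proof.
intros Hf0; induction n as [|n IH]; intros Hf.
- intros x; apply (continuous_comp f Rinv); [apply Hf|].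
  now apply continuous_Rinv.
- assert (Hi := IH (Ck_pred _ _ Hf)).
  destruct Hf as [Hf1 Hf2]; split.
  + intros x; now apply ex_derive_inv.
  + replace (Derive (fun x => / f x)) with
      (fun x => (-1 * Derive f x) * (/ f x * / f x)).
    * apply Ck_mult; [|now apply Ck_mult].
      apply (Ck_mult n (fun _ => -1)); [apply Ck_const|exact Hf2].
    * apply functional_extensionality; intros x.
      rewrite Derive_inv by trivial; now field.
Qed.

Lemma Derive_n_Derive f m : Derive_n (Derive f) m = Derive_n f (S m).
Proof.
apply functional_extensionality; intros x.
change (Derive f) with (Derive_n f 1).
now rewrite Derive_n_comp, Nat.add_1_r.
Qed.

Lemma Ck_Derive_n n m f : Ck (m + n) f -> Ck n (Derive_n f m).
Proof.
revert f; induction m as [|m IH]; intros f H; [exact H|].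
rewrite <- Derive_n_Derive; apply IH, H.
Qed.

Lemma Ck_ex_derive_n n m f x : (m <= n)%nat -> Ck n f -> ex_derive_n f m x.
Proof.
destruct m as [|m]; intros Hm Hf; [exact I|].
assert (H : Ck 1 (Derive_n f m)).
{ apply Ck_Derive_n, (Ck_le n); [lia|exact Hf]. }
apply H.
Qed.

Lemma smooth_Ck f :
  (forall m x, ex_derive_n f m x) <-> (forall n, Ck n f).
Proof.
split.
- intros H n; revert f H; induction n as [|n IH]; intros f H.
  + intros x; apply (ex_derive_continuous f), (H 1%nat).
  + split; [exact (H 1%nat)|].
    apply IH; intros m x; destruct m as [|m]; [exact I|].
    unfold ex_derive_n; rewrite Derive_n_Derive; exact (H (S (S m)) x).
- intros H m x; apply (Ck_ex_derive_n m); [lia|apply H].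
Qed.

(** Applying the product rule [m] times yields [2 ^ m] terms, each a product of an [i]-th and a
    [j]-th derivative with [i + j = m]; this crude count replaces the binomial coefficients of
    Leibniz' formula. *)
Lemma Derive_n_mult_bound m r u x B :
  Ck m r -> Ck m u ->
  (forall i j, (i + j <= m)%nat ->
    Rabs (Derive_n r i x) * Rabs (Derive_n u j x) <= B) ->
  Rabs (Derive_n (fun t => r t * u t) m x) <= 2 ^ m * B.
Proof.
revert r u; induction m as [|m IH]; intros r u Hr Hu HB.
- simpl; rewrite Rabs_mult, Rmult_1_l; now apply (HB 0%nat 0%nat).
- assert (Hr0 := Ck_pred _ _ Hr); assert (Hu0 := Ck_pred _ _ Hu).
  destruct Hr as [Hr1 Hr2], Hu as [Hu1 Hu2].
  rewrite <- Derive_n_Derive, Derive_fun_mult by assumption.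
  rewrite (Derive_n_plus (fun t => Derive r t * u t) (fun t => r t * Derive u t));
    try (apply filter_forall; intros y k Hk; apply (Ck_ex_derive_n m);
      [exact Hk|now apply Ck_mult]).
  eapply Rle_trans; [apply Rabs_triang|].
  replace (2 ^ S m * B) with (2 ^ m * B + 2 ^ m * B) by (simpl; ring).
  apply Rplus_le_compat; apply IH; try assumption; intros i j Hij;
    rewrite Derive_n_Derive; apply HB; lia.
Qed.

Lemma Derive_n_minus_Ck m n f g : (m <= n)%nat -> Ck n f -> Ck n g ->
  Derive_n (fun t => f t - g t) m = (fun x => Derive_n f m x - Derive_n g m x).
Proof.
intros Hm Hf Hg; apply functional_extensionality; intros x.
apply Derive_n_minus; apply filter_forall; intros y k Hk;
  apply (Ck_ex_derive_n n); (lia || assumption).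
Qed.

Lemma Lipschitz_of_Derive (f : R -> R) M : (forall x, ex_derive f x) ->
  (forall x, Rabs (Derive f x) <= M) -> forall x y, Rabs (f y - f x) <= M * Rabs (y - x).
Proof.
intros Hf HM x y.
destruct (MVT_gen f x y (Derive f)) as [c [_ Hc]].
- intros z _; now apply Derive_correct.
- intros z _; apply continuity_pt_filterlim.
  apply (ex_derive_continuous f), Hf.
- rewrite Hc, Rabs_mult; apply Rmult_le_compat_r; [apply Rabs_pos|apply HM].
Qed.

Lemma bounded_of_compact_support (f : R -> R) a :
  (forall x, continuous f x) -> (forall x, a < Rabs x -> f x = 0) ->
  exists M, forall x, Rabs (f x) <= M.
Proof.
intros Hc H0.
destruct (Rle_lt_dec 0 a) as [Ha|Ha].
- destruct (continuity_ab_maj (fun x => Rabs (f x)) (-a) a) as [m [Hm _]]; [lra| |].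
  + intros c _; apply continuity_pt_filterlim.
    apply (continuous_comp f Rabs); [apply Hc|apply continuous_Rabs].
  + exists (Rabs (f m)); intros x.
    destruct (Rle_lt_dec (Rabs x) a) as [Hx|Hx].
    * apply Hm; now apply Rabs_le_between.
    * rewrite H0 by exact Hx; rewrite Rabs_R0; apply Rabs_pos.
- exists 0; intros x; rewrite H0; [rewrite Rabs_R0; lra|].
  generalize (Rabs_pos x); lra.
Qed.

Lemma common_bound (P : nat -> R -> Prop) :
  (forall i M M', M <= M' -> P i M -> P i M') -> (forall i, exists M, P i M) ->
  forall n, exists M, 0 <= M /\ forall i, (i <= n)%nat -> P i M.
Proof.
intros Hm HP n; induction n as [|n [M [M0 HM]]].
- destruct (HP 0%nat) as [M HM]; exists (Rmax 0 M); split; [apply Rmax_l|].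
  intros i Hi; replace i with 0%nat by lia; apply (Hm _ M); [apply Rmax_r|exact HM].
- destruct (HP (S n)) as [M' HM']; exists (Rmax M M'); split.
  { eapply Rle_trans; [exact M0|apply Rmax_l]. }
  intros i Hi; destruct (Nat.eq_dec i (S n)) as [->|Hn].
  + apply (Hm _ M'); [apply Rmax_r|exact HM'].
  + apply (Hm _ M); [apply Rmax_l|apply HM; lia].
Qed.

(** * Cutoffs and Taylor remainders *)

Lemma is_derive_x_Rabs x : is_derive (fun t => t * Rabs t) x (2 * Rabs x).
Proof.
apply is_derive_Reals; intros eps Heps; exists (mkposreal eps Heps).
intros h Hh0 Hh; simpl in Hh.
assert (E : Rabs ((x + h) * Rabs (x + h) - x * Rabs x - 2 * Rabs x * h) <= h * h).
{ apply Rabs_le; unfold Rabs.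
  destruct (Rcase_abs (x + h)), (Rcase_abs x); split; nra. }
replace (((x + h) * Rabs (x + h) - x * Rabs x) / h - 2 * Rabs x)
  with (((x + h) * Rabs (x + h) - x * Rabs x - 2 * Rabs x * h) / h)
  by (field; exact Hh0).
unfold Rdiv; rewrite Rabs_mult, Rabs_inv.
apply Rle_lt_trans with (Rabs h); [|exact Hh].
assert (Hp := Rabs_pos_lt h Hh0).
apply (Rmult_le_reg_r (Rabs h)); [exact Hp|].
rewrite Rmult_assoc, Rinv_l by lra; rewrite Rmult_1_r.
eapply Rle_trans; [exact E|].
rewrite <- Rabs_mult; apply Rle_abs.
Qed.

(** The derivative of [x ^ (n+1) * |x|] is [(n+2) * x ^ n * |x|], so each power of [x] buys one
    derivative. *)
Lemma Ck_pow_Rabs n : Ck n (fun x => x ^ n * Rabs x).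
Proof.
induction n as [|n IH].
- intros x; apply (continuous_mult (fun _ => 1) Rabs);
    [apply continuous_const|apply continuous_Rabs].
- assert (D : forall x, is_derive (fun x => x ^ S n * Rabs x) x
                (INR (S (S n)) * (x ^ n * Rabs x))).
  { intros x.
    (* Grouping one [x] with [|x|] leaves two differentiable factors; [|x|] alone has no derivative
       at 0. *)
    apply is_derive_ext with (fun x => x ^ n * (x * Rabs x)).
    { intros t; simpl; ring. }
    replace (INR (S (S n)) * (x ^ n * Rabs x)) with
      (INR n * 1 * x ^ pred n * (x * Rabs x) + x ^ n * (2 * Rabs x)).
    - apply (is_derive_mult (fun x => x ^ n) (fun x => x * Rabs x)).
      + apply (is_derive_pow (fun x => x)), @is_derive_id.
      + apply is_derive_x_Rabs.
      + apply Rmult_comm.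
    - rewrite !S_INR; destruct n as [|n]; simpl pred; [simpl; ring|].
      simpl; ring. }
  split; [intros x; eexists; apply D|].
  replace (Derive (fun x => x ^ S n * Rabs x)) with
    (fun x => INR (S (S n)) * (x ^ n * Rabs x)).
  + apply (Ck_mult n (fun _ => INR (S (S n)))); [apply Ck_const|exact IH].
  + apply functional_extensionality; intros x; symmetry.
    apply is_derive_unique, D.
Qed.

Lemma Derive_n_support f a : (forall x, a < Rabs x -> f x = 0) ->
  forall m x, a < Rabs x -> Derive_n f m x = 0.
Proof.
intros Hf m; induction m as [|m IH]; intros x Hx; [now apply Hf|].
simpl; rewrite (Derive_ext_loc _ (fun _ => 0)); [apply Derive_const|].
assert (H : locally x (fun y => a < Rabs y)).
{ apply (continuous_Rabs x (fun y => a < y)), open_gt, Hx. }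
now revert H; apply filter_imp.
Qed.

Lemma Ck_support_bounded n f a : Ck n f -> (forall x, a < Rabs x -> f x = 0) ->
  exists M, 0 <= M /\ forall j, (j <= n)%nat -> forall x, Rabs (Derive_n f j x) <= M.
Proof.
intros Hf H0.
destruct (common_bound
  (fun j M => (j <= n)%nat -> forall x, Rabs (Derive_n f j x) <= M))
  with (n := n) as [M [M0 HM]].
- intros i M M' HMM HM Hi x; eapply Rle_trans; [now apply HM|exact HMM].
- intros j; destruct (Compare_dec.le_dec j n) as [Hj|Hj]; [|exists 0; lia].
  destruct (bounded_of_compact_support (Derive_n f j) a) as [M HM].
  + apply (Ck_continuous 0), Ck_Derive_n, (Ck_le n); [lia|exact Hf].
  + now apply Derive_n_support.
  + now exists M.
- exists M; split; [exact M0|intros j Hj; now apply HM].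
Qed.

Lemma Derive_n_scale_Ck f a n : Ck n f ->
  forall m x, (m <= n)%nat ->
    Derive_n (fun t => f (a * t)) m x = a ^ m * Derive_n f m (a * x).
Proof.
intros Hf m x Hm; apply Derive_n_comp_scal, filter_forall.
intros y k Hk; apply (Ck_ex_derive_n n); [lia|exact Hf].
Qed.

(** Since [(y + |y|) / 2] is the positive part of [y], this is the power [n + 1] of the positive
    part of [1 - x^2], a function of class C^n supported in [-1, 1]. *)
Definition bump (n : nat) (x : R) : R :=
  (1 - x * x) ^ n * (1 - x * x + Rabs (1 - x * x)) * / 2.

Lemma Ck_bump n : Ck n (bump n).
Proof.
assert (Hq : Ck n (fun x => 1 - x * x)).
{ apply Ck_minus; [apply Ck_const|apply Ck_mult; apply Ck_id]. }
assert (H : Ck n (fun y => y ^ n * (y + Rabs y) * / 2)).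
{ apply Ck_mult; [|apply Ck_const].
  replace (fun y => y ^ n * (y + Rabs y)) with
    (fun y => y ^ n * y + y ^ n * Rabs y)
    by (apply functional_extensionality; intros; ring).
  apply Ck_plus; [|apply Ck_pow_Rabs].
  apply Ck_mult; [apply Ck_pow|]; apply Ck_id. }
exact (Ck_comp n _ _ H Hq).
Qed.

Lemma bump_0 n : bump n 0 = 1.
Proof.
unfold bump; rewrite Rmult_0_r, Rminus_0_r, pow1, Rabs_R1; field.
Qed.

Lemma bump_support n x : 1 < Rabs x -> bump n x = 0.
Proof.
intros Hx; unfold bump; rewrite (Rabs_left (1 - x * x)); [ring|].
assert (H : x * x = Rabs x * Rabs x).
{ now rewrite <- Rabs_mult, Rabs_pos_eq by apply Rle_0_sqr. }
nra.
Qed.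

(** Dilate a bump by a small [r]. The difference [1 - f (r x)] does not become small at infinity,
    but it is at most [r M |x|] by the Lipschitz bound, and every derivative carries a factor
    [r]. *)
Lemma cutoff_exists n eps : 0 < eps ->
  exists chi a, Ck n chi /\ (forall x, a < Rabs x -> chi x = 0) /\
    forall j, (j <= n)%nat -> forall x,
      Rabs (Derive_n (fun t => 1 - chi t) j x) <= eps * (1 + Rabs x).
Proof.
intros Heps.
set (f := bump (S n)).
assert (Hf : Ck (S n) f) by apply Ck_bump.
destruct (Ck_support_bounded (S n) f 1 Hf (bump_support (S n)))
  as [M [M0 HM]].
(* This choice gives both [r <= 1], so that [r ^ j <= r] for [j >= 1], and [r * M <= eps]. *)
set (r := eps / (M + eps)).
assert (Hr : 0 < r) by (apply Rdiv_lt_0_compat; lra).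
assert (Hr' : r * (M + eps) = eps) by (unfold r; field; lra).
assert (Hr1 : r <= 1) by nra.
assert (HrM : r * M <= eps) by nra.
exists (fun t => f (r * t)), (/ r).
assert (Hc : Ck (S n) (fun t => f (r * t))).
{ apply (Ck_comp (S n) f (fun t => r * t) Hf).
  apply (Ck_mult (S n) (fun _ => r)); [apply Ck_const|apply Ck_id]. }
split; [now apply Ck_pred|split].
- intros x Hx; apply bump_support.
  rewrite Rabs_mult, (Rabs_pos_eq r) by lra.
  apply (Rmult_lt_compat_l r) in Hx; [|exact Hr].
  rewrite Rinv_r in Hx; lra.
- intros j Hj x.
  assert (Hx := Rabs_pos x).
  destruct j as [|j].
  + simpl; rewrite <- (bump_0 (S n)) at 1; fold f.
    eapply Rle_trans.
    { apply (Lipschitz_of_Derive f M); [apply Hf|].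
      intros y; apply (HM 1%nat); lia. }
    rewrite Rminus_0_l, Rabs_Ropp, Rabs_mult, (Rabs_pos_eq r) by lra.
    apply (Rmult_le_compat_r (Rabs x)) in HrM; [|exact Hx]; lra.
  + rewrite (Derive_n_minus_Ck (S j) (S n)) by (lia || apply Ck_const || exact Hc).
    rewrite (Derive_n_scale_Ck f r (S n)) by (lia || exact Hf).
    rewrite Derive_n_const, Rminus_0_l, Rabs_Ropp, Rabs_mult.
    rewrite Rabs_pos_eq by (apply pow_le; lra).
    assert (H1 : r ^ S j <= r).
    { simpl; assert (H := pow_incr r 1 j (conj (Rlt_le _ _ Hr) Hr1)).
      rewrite pow1 in H; nra. }
    assert (H2 := HM (S j) ltac:(lia) (r * x)).
    assert (H3 := Rabs_pos (Derive_n f (S j) (r * x))).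
    assert (H4 := pow_le r (S j) (Rlt_le _ _ Hr)).
    apply Rle_trans with (r * M); [now apply Rmult_le_compat|nra].
Qed.

(** Sine and cosine form one family because it is closed under derivation with [xi] fixed:
    inductions on the order of derivation only change the coefficients. *)
Definition trig (a b xi x : R) : R := a * cos (xi * x) + b * sin (xi * x).

Lemma is_derive_trig a b xi x :
  is_derive (trig a b xi) x (trig (b * xi) (- a * xi) xi x).
Proof. unfold trig; auto_derive; [exact I|ring]. Qed.

Lemma Derive_trig a b xi : Derive (trig a b xi) = trig (b * xi) (- a * xi) xi.
Proof.
apply functional_extensionality; intros x; apply is_derive_unique, is_derive_trig.
Qed.

Lemma Ck_trig n a b xi : Ck n (trig a b xi).
Proof.
revert a b; induction n as [|n IH]; intros a b.
- intros x; apply (ex_derive_continuous (trig a b xi)); eexists; apply is_derive_trig.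
- split; [intros x; eexists; apply is_derive_trig|].
  rewrite Derive_trig; apply IH.
Qed.

Lemma Derive_n_trig_bound a b xi m x :
  Rabs (Derive_n (trig a b xi) m x) <= (Rabs a + Rabs b) * Rabs xi ^ m.
Proof.
revert a b; induction m as [|m IH]; intros a b.
- simpl; unfold trig.
  eapply Rle_trans; [apply Rabs_triang|]; rewrite !Rabs_mult.
  assert (H1 : Rabs (cos (xi * x)) <= 1) by apply Rabs_le, COS_bound.
  assert (H2 : Rabs (sin (xi * x)) <= 1) by apply Rabs_le, SIN_bound.
  assert (Ha := Rabs_pos a); assert (Hb := Rabs_pos b); nra.
- rewrite <- Derive_n_Derive, Derive_trig.
  eapply Rle_trans; [apply IH|].
  rewrite !Rabs_mult, Rabs_Ropp; simpl; apply Req_le; ring.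
Qed.

(** The index counts the terms, so the degree is below [n]: the remainder has order [x ^ n], and
    derivation lowers the index by one. *)
Fixpoint taylor (n : nat) (f : R -> R) (x : R) : R :=
  match n with
  | O => 0
  | S n => taylor n f x + Derive_n f n 0 / INR (fact n) * x ^ n
  end.

Lemma is_derive_taylor n f x :
  is_derive (taylor (S n) f) x (taylor n (Derive f) x).
Proof.
induction n as [|n IH].
- apply is_derive_ext with (fun _ => f 0); [intros t; simpl; field|].
  apply @is_derive_const.
- change (taylor (S (S n)) f) with
    (fun x => taylor (S n) f x + Derive_n f (S n) 0 / INR (fact (S n)) * x ^ S n).
  change (taylor (S n) (Derive f) x) with
    (taylor n (Derive f) x + Derive_n (Derive f) n 0 / INR (fact n) * x ^ n).
  apply (is_derive_plus (taylor (S n) f)); [exact IH|].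
  rewrite Derive_n_Derive.
  replace (Derive_n f (S n) 0 / INR (fact n) * x ^ n) with
    (Derive_n f (S n) 0 / INR (fact (S n)) * (INR (S n) * 1 * x ^ pred (S n))).
  + apply is_derive_scal, (is_derive_pow (fun x => x)), @is_derive_id.
  + rewrite fact_simpl, mult_INR; simpl pred.
    field; split; [apply INR_fact_neq_0|apply not_0_INR; lia].
Qed.

Lemma Ck_taylor k n f : Ck k (taylor n f).
Proof.
induction n as [|n IH]; simpl; [apply Ck_const|].
apply Ck_plus; [exact IH|].
apply Ck_mult; [apply Ck_const|apply Ck_pow, Ck_id].
Qed.

Lemma taylor_at_0 n f : taylor (S n) f 0 = f 0.
Proof.
induction n as [|n IH]; [simpl; field|].
change (taylor (S n) f 0 + Derive_n f (S n) 0 / INR (fact (S n)) * 0 ^ S n = f 0).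
rewrite IH; simpl pow; ring.
Qed.

(** On the positive half-line the bound minus [f] has nonnegative derivative and vanishes at 0. The
    other cases follow by replacing [f] with [- f] and [x] with [- x]. *)
Lemma abs_le_of_derive_abs_le (f : R -> R) Y n : (forall x, ex_derive f x) -> f 0 = 0 ->
  (forall x, Rabs (Derive f x) <= Y * (Rabs x ^ n / INR (fact n))) ->
  forall x, Rabs (f x) <= Y * (Rabs x ^ S n / INR (fact (S n))).
Proof.
assert (P : forall g, (forall x, ex_derive g x) -> g 0 = 0 ->
  (forall x, Rabs (Derive g x) <= Y * (Rabs x ^ n / INR (fact n))) ->
  forall x, 0 <= x -> g x <= Y * (x ^ S n / INR (fact (S n)))).
{ intros g Hg g0 HD x Hx.
  destruct (MVT_gen (fun t => Y * (t ^ S n / INR (fact (S n))) - g t) 0 x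
    (fun t => Y * (t ^ n / INR (fact n)) - Derive g t)) as [c [Hc E]].
  - intros t _.
    apply (is_derive_minus (fun t => Y * (t ^ S n / INR (fact (S n)))) g);
      [|now apply Derive_correct].
    replace (Y * (t ^ n / INR (fact n))) with
      (Y * (/ INR (fact (S n)) * (INR (S n) * 1 * t ^ pred (S n)))).
    + apply is_derive_scal.
      apply is_derive_ext with (fun t => / INR (fact (S n)) * t ^ S n).
      { intros u; apply Rmult_comm. }
      apply is_derive_scal, (is_derive_pow (fun x => x)), @is_derive_id.
    + rewrite fact_simpl, mult_INR; simpl pred.
      field; split; [apply INR_fact_neq_0|apply not_0_INR; lia].
  - intros t _; apply continuity_pt_filterlim.
    apply (ex_derive_continuous (fun t => Y * (t ^ S n / INR (fact (S n))) - g t)).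
    apply (ex_derive_minus (fun t => Y * (t ^ S n / INR (fact (S n)))) g);
      [|apply Hg].
    auto_derive; exact I.
  - rewrite Rmin_left in Hc by lra.
    assert (HDc := HD c); rewrite (Rabs_pos_eq c) in HDc by apply Hc.
    apply Rabs_le_between in HDc.
    rewrite g0 in E; simpl pow in E at 2; unfold Rdiv in E at 2.
    rewrite !Rmult_0_l, Rmult_0_r, !Rminus_0_r in E.
    assert (0 <= (Y * (c ^ n / INR (fact n)) - Derive g c) * x)
      by (apply Rmult_le_pos; lra).
    lra. }
assert (Q : forall g, (forall x, ex_derive g x) -> g 0 = 0 ->
  (forall x, Rabs (Derive g x) <= Y * (Rabs x ^ n / INR (fact n))) ->
  forall x, 0 <= x -> Rabs (g x) <= Y * (x ^ S n / INR (fact (S n)))).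
{ intros g Hg g0 HD x Hx; apply Rabs_le; split; [|now apply P].
  enough (- g x <= Y * (x ^ S n / INR (fact (S n)))) by lra.
  apply (P (fun t => - g t)); [|rewrite g0; apply Ropp_0| |exact Hx].
  - intros t; now apply (ex_derive_opp g).
  - intros t; now rewrite Derive_opp, Rabs_Ropp. }
intros Hf f0 HD x.
destruct (Rle_lt_dec 0 x) as [Hx|Hx].
- rewrite (Rabs_pos_eq x) by exact Hx; now apply Q.
- rewrite (Rabs_left x) by exact Hx.
  assert (E : forall t, is_derive (fun t => f (- t)) t (- Derive f (- t))).
  { intros t; replace (- Derive f (- t)) with (-1 * Derive f (- t)) by ring.
    apply (is_derive_comp f); [now apply Derive_correct|].
    auto_derive; [exact I|ring]. }
  replace (f x) with (f (- - x)) by (f_equal; ring).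
  apply (Q (fun t => f (- t))); [| | |lra].
  + intros t; eexists; apply E.
  + now rewrite Ropp_0.
  + intros t; rewrite (is_derive_unique _ _ _ (E t)), Rabs_Ropp.
    eapply Rle_trans; [apply HD|]; rewrite Rabs_Ropp; apply Rle_refl.
Qed.

(** Derivation turns the remainder of [f] with [n + 1] terms into that of [Derive f] with [n] terms,
    so the bound [Y] is integrated [n] times from 0. *)
Lemma taylor_remainder n f Y : Ck n f -> (forall x, Rabs (Derive_n f n x) <= Y) ->
  forall x, Rabs (f x - taylor n f x) <= Y * (Rabs x ^ n / INR (fact n)).
Proof.
revert f; induction n as [|n IH]; intros f Hf HY x.
- simpl; rewrite Rminus_0_r.
  replace (Y * (1 / 1)) with Y by field; apply HY.
- destruct Hf as [Hf1 Hf2].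
  apply (abs_le_of_derive_abs_le (fun x => f x - taylor (S n) f x)).
  + intros t; apply (ex_derive_minus f); [apply Hf1|].
    eexists; apply is_derive_taylor.
  + rewrite taylor_at_0; ring.
  + intros t; rewrite Derive_minus; [|apply Hf1|eexists; apply is_derive_taylor].
    rewrite (is_derive_unique _ _ _ (is_derive_taylor n f t)).
    apply IH; [exact Hf2|].
    intros y; rewrite Derive_n_Derive; apply HY.
Qed.

Lemma Derive_n_taylor_remainder n f Y j : (j <= n)%nat -> Ck n f ->
  (forall x, Rabs (Derive_n f n x) <= Y) ->
  forall x, Rabs (Derive_n (fun t => f t - taylor n f t) j x) <=
    Y * (Rabs x ^ (n - j) / INR (fact (n - j))).
Proof.
revert f n; induction j as [|j IH]; intros f n Hj Hf HY x.
- rewrite Nat.sub_0_r; now apply taylor_remainder.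
- destruct n as [|n]; [lia|]; destruct Hf as [Hf1 Hf2].
  rewrite <- Derive_n_Derive.
  replace (Derive (fun t => f t - taylor (S n) f t))
    with (fun t => Derive f t - taylor n (Derive f) t).
  + apply IH; [lia|exact Hf2|].
    intros y; rewrite Derive_n_Derive; apply HY.
  + apply functional_extensionality; intros t; symmetry.
    rewrite Derive_minus; [|apply Hf1|eexists; apply is_derive_taylor].
    now rewrite (is_derive_unique _ _ _ (is_derive_taylor n f t)).
Qed.

(** A binomial coefficient is at most [2 ^ (a + b)]; the induction is Pascal's rule, splitting the
    leading factor of the factorial as [a] plus [b]. It isolates, in the factorial of the decay
    condition, the part that cancels against the Taylor remainder. *)
Lemma fact_plus_le a b :
  INR (fact (a + b)) <= 2 ^ (a + b) * INR (fact a) * INR (fact b).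
Proof.
assert (P2 : forall n, 1 <= 2 ^ n) by (intros; apply pow_R1_Rle; lra).
assert (F : forall n, 0 < INR (fact n)) by apply INR_fact_lt_0.
enough (H : forall n a b, (a + b <= n)%nat ->
  INR (fact (a + b)) <= 2 ^ (a + b) * INR (fact a) * INR (fact b))
  by now apply (H (a + b)%nat).
clear a b; intros n; induction n as [|n IH]; intros a b Hab;
  (destruct a as [|a];
   [generalize (P2 (0 + b)%nat) (F b); change (INR (fact 0)) with 1; simpl Nat.add; nra|]);
  (destruct b as [|b];
   [rewrite Nat.add_0_r; generalize (P2 (S a)) (F (S a));
    change (INR (fact 0)) with 1; nra|]); [lia|].
assert (H1 := IH a (S b) ltac:(lia)); assert (H2 := IH (S a) b ltac:(lia)).
replace (S a + S b)%nat with (S (S (a + b))) by lia.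
replace (a + S b)%nat with (S (a + b)) in H1 by lia.
replace (S a + b)%nat with (S (a + b)) in H2 by lia.
assert (Ha := pos_INR (S a)); assert (Hb := pos_INR (S b)).
rewrite (fact_simpl (S (a + b))), mult_INR.
replace (INR (S (S (a + b)))) with (INR (S a) + INR (S b))
  by (rewrite <- plus_INR; f_equal; lia).
apply (Rmult_le_compat_l (INR (S a))) in H1; [|exact Ha].
apply (Rmult_le_compat_l (INR (S b))) in H2; [|exact Hb].
rewrite (fact_simpl b), mult_INR in H1; rewrite (fact_simpl a), mult_INR in H2.
rewrite (fact_simpl b), (fact_simpl a), !mult_INR.
change (2 ^ S (S (a + b))) with (2 * 2 ^ S (a + b)).
nra.
Qed.

(** * Multiplication by trigonometric polynomials *)

(** These are the properties of the functions on which two distributions agree that the density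
    argument uses. In [cs_lim] a single [N] bounds both the weight and the order of derivation,
    which suffices because larger [N] controls more seminorms. *)
Record closed_subspace (V : (R -> R) -> Prop) : Prop := ClosedSubspace {
  cs_rschwartz : forall u, V u -> is_rschwartz u;
  cs_plus : forall u v, V u -> V v -> V (fun x => u x + v x);
  cs_scal : forall a u, V u -> V (fun x => a * u x);
  cs_lim : forall u, is_rschwartz u ->
    (forall N eps, 0 < eps -> exists v, V v /\
      forall m x, (m <= N)%nat ->
        (1 + Rabs x) ^ N * Rabs (Derive_n (fun t => u t - v t) m x) <= eps) ->
    V u
}.

(** The shift [p] gives room for multiplication by [x]: a factor [x] costs one more weight, which
    raises [p] by one and puts a factor [A] into the constant. Thus the rate [A] itself is
    preserved. *)
Definition fact_decay (A : R) (p : nat) (u : R -> R) : Prop :=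
  forall m, exists C, 0 <= C /\ forall k x,
    (1 + Rabs x) ^ k * Rabs (Derive_n u m x) <= C * (A ^ k * INR (fact (k + p))).

Lemma is_rschwartz_Ck u n : is_rschwartz u -> Ck n u.
Proof. intros [H _]; now apply smooth_Ck. Qed.

Lemma fact_decay_rschwartz A p u :
  (forall n, Ck n u) -> fact_decay A p u -> is_rschwartz u.
Proof.
intros Hu Hd; split; [now apply smooth_Ck|].
intros k m; destruct (Hd m) as [C [_ HC]]; eexists; apply HC.
Qed.

Lemma fact_decay_le A p q u : 0 < A -> (p <= q)%nat ->
  fact_decay A p u -> fact_decay A q u.
Proof.
intros HA Hpq Hu m; destruct (Hu m) as [C [C0 HC]]; exists C; split; [exact C0|].
intros k x; eapply Rle_trans; [apply HC|].
apply Rmult_le_compat_l; [exact C0|].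
apply Rmult_le_compat_l; [apply pow_le; lra|].
apply le_INR, fact_le; lia.
Qed.

Lemma fact_decay_plus A p u v : is_rschwartz u -> is_rschwartz v ->
  fact_decay A p u -> fact_decay A p v -> fact_decay A p (fun x => u x + v x).
Proof.
intros [Su _] [Sv _] Hu Hv m.
destruct (Hu m) as [C [C0 HC]], (Hv m) as [D [D0 HD]].
exists (C + D); split; [lra|]; intros k x.
rewrite Derive_n_plus by now apply filter_forall.
specialize (HC k x); specialize (HD k x).
assert (H := Rabs_triang (Derive_n u m x) (Derive_n v m x)).
assert (Hw := weight_pos k x); nra.
Qed.

Lemma fact_decay_scal A p a u :
  fact_decay A p u -> fact_decay A p (fun x => a * u x).
Proof.
intros Hu m; destruct (Hu m) as [C [C0 HC]].
assert (Ha := Rabs_pos a).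
exists (Rabs a * C); split; [nra|]; intros k x.
rewrite Derive_n_scal_l, Rabs_mult; specialize (HC k x); nra.
Qed.

Lemma fact_decay_mulx A p u : 0 < A -> is_rschwartz u ->
  fact_decay A p u -> fact_decay A (S p) (fun x => x * u x).
Proof.
intros HA [Su _] Hu m.
destruct (Hu m) as [C [C0 HC]], (Hu (pred m)) as [D [D0 HD]].
assert (Hm := pos_INR m).
exists (C * A + INR m * D); split; [nra|]; intros k x.
rewrite Derive_n_mulx by exact Su.
specialize (HC (S k) x); specialize (HD k x); simpl pow in HC.
replace (S k + p)%nat with (k + S p)%nat in HC by lia.
assert (HF : INR (fact (k + p)) <= INR (fact (k + S p)))
  by (apply le_INR, fact_le; lia).
assert (Hw := weight_pos k x); assert (HAk := pow_lt A k HA).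
set (a := Derive_n u m x) in *; set (b := Derive_n u (pred m) x) in *.
assert (H : Rabs (x * a + INR m * b) <= (1 + Rabs x) * Rabs a + INR m * Rabs b).
{ eapply Rle_trans; [apply Rabs_triang|].
  rewrite !Rabs_mult, (Rabs_pos_eq (INR m)) by exact Hm.
  generalize (Rabs_pos a); nra. }
set (w := (1 + Rabs x) ^ k) in *.
apply Rle_trans with (w * ((1 + Rabs x) * Rabs a) + INR m * (w * Rabs b)); [nra|].
assert (HD' : w * Rabs b <= D * (A ^ k * INR (fact (k + S p)))).
{ eapply Rle_trans; [exact HD|].
  apply Rmult_le_compat_l; [exact D0|]; apply Rmult_le_compat_l; lra. }
apply (Rmult_le_compat_l (INR m)) in HD'; [|exact Hm].
nra.
Qed.

Lemma fact_decay_common A p u n : fact_decay A p u -> 0 < A ->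
  exists C, 0 <= C /\ forall m, (m <= n)%nat -> forall k x,
    (1 + Rabs x) ^ k * Rabs (Derive_n u m x) <= C * (A ^ k * INR (fact (k + p))).
Proof.
intros Hu HA.
apply (common_bound (fun m C => forall k x,
  (1 + Rabs x) ^ k * Rabs (Derive_n u m x) <= C * (A ^ k * INR (fact (k + p))))).
- intros i M M' HM H k x; eapply Rle_trans; [apply H|].
  apply Rmult_le_compat_r; [|exact HM].
  apply Rmult_le_pos; [apply pow_le; lra|apply pos_INR].
- intros i; destruct (Hu i) as [C [_ HC]]; now exists C.
Qed.

(** Up to order [m], the derivatives of the trigonometric factor cost at most a multiple of
    [(1 + |xi|) ^ m]. This does not depend on [k] and goes into the constant, so [A] and [p] stay
    the same. *)
Lemma fact_decay_trig A p a b xi u : 0 < A -> (forall n, Ck n u) ->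
  fact_decay A p u -> fact_decay A p (fun x => trig a b xi x * u x).
Proof.
intros HA Su Hu m.
destruct (fact_decay_common A p u m Hu HA) as [C [C0 HC]].
set (D := (Rabs a + Rabs b) * (1 + Rabs xi) ^ m).
assert (D0 : 0 <= D).
{ apply Rmult_le_pos; [|apply Rlt_le, weight_pos].
  generalize (Rabs_pos a) (Rabs_pos b); lra. }
exists (2 ^ m * (D * C)); split.
{ apply Rmult_le_pos; [apply pow_le; lra|now apply Rmult_le_pos]. }
intros k x; assert (Hw := weight_pos k x).
set (w := (1 + Rabs x) ^ k) in *; set (F := A ^ k * INR (fact (k + p))).
(* [Derive_n_mult_bound] concerns unweighted derivatives at the point [x], so the weight is divided
   out of the target. *)
apply Rle_trans with (w * (2 ^ m * (D * (C * F) / w))).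
- apply Rmult_le_compat_l; [lra|].
  apply Derive_n_mult_bound; [apply Ck_trig|apply Su|].
  intros i j Hij.
  assert (H1 : Rabs (Derive_n (trig a b xi) i x) <= D).
  { eapply Rle_trans; [apply Derive_n_trig_bound|].
    apply Rmult_le_compat_l; [generalize (Rabs_pos a) (Rabs_pos b); lra|].
    assert (Hx := Rabs_pos xi).
    apply Rle_trans with ((1 + Rabs xi) ^ i); [apply pow_incr; lra|].
    apply Rle_pow; [lra|lia]. }
  assert (H2 := HC j ltac:(lia) k x); fold w F in H2.
  apply (Rmult_le_reg_r w); [exact Hw|].
  replace (D * (C * F) / w * w) with (D * (C * F)) by (field; lra).
  rewrite Rmult_assoc, (Rmult_comm (Rabs (Derive_n u j x))).
  apply Rmult_le_compat; try assumption; [apply Rabs_pos|].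
  apply Rmult_le_pos; [lra|apply Rabs_pos].
- apply Req_le; field; lra.
Qed.

(** [V] need not be stable under multiplication by [x], so all moments are carried along; they put
    Taylor polynomials times [u] in [V]. Only [A] is fixed, while [p] may grow. *)
Definition admissible (V : (R -> R) -> Prop) (A : R) (u : R -> R) : Prop :=
  (exists p, fact_decay A p u) /\ forall n, V (fun x => x ^ n * u x).

Section Admissible.

Variables (V : (R -> R) -> Prop) (A : R).
Hypotheses (HV : closed_subspace V) (HA : 0 < A).

Lemma admissible_V u : admissible V A u -> V u.
Proof.
intros [_ H]; specialize (H 0%nat).
replace u with (fun x => x ^ 0 * u x); [exact H|].
apply functional_extensionality; intros x; simpl; ring.
Qed.

Lemma admissible_Ck u : admissible V A u -> forall n, Ck n u.
Proof. intros H n; apply is_rschwartz_Ck, (cs_rschwartz V HV), admissible_V, H. Qed.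

Lemma admissible_plus u v : admissible V A u -> admissible V A v ->
  admissible V A (fun x => u x + v x).
Proof.
intros Hu Hv.
assert (Su := cs_rschwartz V HV _ (admissible_V u Hu)).
assert (Sv := cs_rschwartz V HV _ (admissible_V v Hv)).
destruct Hu as [[p Hp] Hu], Hv as [[q Hq] Hv]; split.
- exists (p + q)%nat; apply fact_decay_plus; try assumption;
    (eapply fact_decay_le; [exact HA| |eassumption]; lia).
- intros n.
  replace (fun x => x ^ n * (u x + v x)) with (fun x => x ^ n * u x + x ^ n * v x)
    by (apply functional_extensionality; intros; ring).
  now apply (cs_plus V HV).
Qed.

Lemma admissible_scal a u : admissible V A u -> admissible V A (fun x => a * u x).
Proof.
intros [[p Hp] Hu]; split.
- exists p; now apply fact_decay_scal.
- intros n.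
  replace (fun x => x ^ n * (a * u x)) with (fun x => a * (x ^ n * u x))
    by (apply functional_extensionality; intros; ring).
  now apply (cs_scal V HV).
Qed.

Lemma admissible_pow u n : admissible V A u -> admissible V A (fun x => x ^ n * u x).
Proof.
intros Hu; induction n as [|n IH].
- replace (fun x => x ^ 0 * u x) with u; [exact Hu|].
  apply functional_extensionality; intros x; simpl; ring.
- replace (fun x => x ^ S n * u x) with (fun x => x * (x ^ n * u x))
    by (apply functional_extensionality; intros x; simpl; ring).
  assert (Sx := cs_rschwartz V HV _ (admissible_V _ IH)).
  destruct IH as [[p Hp] IH]; split.
  + exists (S p); now apply fact_decay_mulx.
  + intros k; destruct Hu as [_ Hu].
    replace (fun x => x ^ k * (x * (x ^ n * u x))) with
      (fun x => x ^ (k + 1 + n) * u x); [apply Hu|].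
    apply functional_extensionality; intros x; rewrite !pow_add; ring.
Qed.

Lemma V_taylor n f u : admissible V A u -> V (fun x => taylor n f x * u x).
Proof.
intros Hu; induction n as [|n IH].
- exact (cs_scal V HV 0 u (admissible_V u Hu)).
- replace (fun x => taylor (S n) f x * u x) with
    (fun x => taylor n f x * u x + Derive_n f n 0 / INR (fact n) * (x ^ n * u x))
    by (apply functional_extensionality; intros x; simpl; ring).
  apply (cs_plus V HV); [exact IH|].
  apply (cs_scal V HV), (proj2 Hu).
Qed.

(* The factorials of the Taylor remainder and of the decay condition cancel, which
   leaves a geometric series of ratio [2 A |xi|]. *)
Lemma V_trig a b xi u : 4 * (A * Rabs xi) <= 1 -> admissible V A u ->
  V (fun x => trig a b xi x * u x).
Proof.
intros Hxi Hu.
assert (Su := admissible_Ck u Hu).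
destruct (proj1 Hu) as [p Hp].
apply (cs_lim V HV).
{ apply fact_decay_rschwartz with A p.
  - intros n; apply Ck_mult; [apply Ck_trig|apply Su].
  - now apply fact_decay_trig. }
intros N eps Heps.
destruct (fact_decay_common A p u N Hp HA) as [C [C0 HC]].
set (X := Rabs xi) in *; assert (HX : 0 <= X) by apply Rabs_pos.
set (Y := Rabs a + Rabs b).
assert (Y0 : 0 <= Y) by (generalize (Rabs_pos a) (Rabs_pos b); unfold Y; lra).
set (q := (N + p)%nat).
(* [E] collects the factors that do not depend on the number [M] of Taylor terms; [q] is the part of
   the factorial index that the Taylor remainder does not cancel. *)
set (E := Y * (1 + X) ^ N * 2 ^ N * C * A ^ N * 2 ^ q * INR (fact q)).
assert (E0 : 0 <= E).
{ unfold E; repeat apply Rmult_le_pos; try apply pos_INR; try apply pow_le; lra. }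
assert (HM : exists M, (N <= M)%nat /\ 2 ^ N * (E * (/ 2) ^ M) <= eps).
{ destruct (pow_lt_1_zero (/ 2)) with (y := eps / (2 ^ N * E + 1)) as [M HM].
  - rewrite Rabs_pos_eq; lra.
  - apply Rdiv_lt_0_compat; [exact Heps|].
    generalize (pow_lt 2 N Rlt_0_2); nra.
  - exists (M + N)%nat; split; [lia|].
    specialize (HM (M + N)%nat ltac:(lia)).
    assert (H2 := pow_lt 2 N Rlt_0_2).
    assert (H3 : 0 < 2 ^ N * E + 1) by nra.
    apply (Rmult_lt_compat_r _ _ _ H3) in HM.
    replace (eps / (2 ^ N * E + 1) * (2 ^ N * E + 1)) with eps in HM by (field; lra).
    assert (H4 := Rle_abs ((/ 2) ^ (M + N))).
    assert (H5 : 0 < (/ 2) ^ (M + N)) by (apply pow_lt; lra).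
    nra. }
destruct HM as [M [HNM HM]].
exists (fun x => taylor M (trig a b xi) x * u x); split; [now apply V_taylor|].
intros m x Hm.
replace (fun t => trig a b xi t * u t - taylor M (trig a b xi) t * u t) with
  (fun t => (trig a b xi t - taylor M (trig a b xi) t) * u t)
  by (apply functional_extensionality; intros t; ring).
assert (Hw := weight_pos N x).
set (w := (1 + Rabs x) ^ N) in *.
apply Rle_trans with (w * (2 ^ m * (E * (/ 2) ^ M / w))).
- apply Rmult_le_compat_l; [lra|].
  apply Derive_n_mult_bound; [|apply Su|].
  { apply Ck_minus; [apply Ck_trig|apply Ck_taylor]. }
  intros i j Hij.
  assert (Hi : (i <= M)%nat) by lia.
  assert (H1 : Rabs (Derive_n (fun t => trig a b xi t - taylor M (trig a b xi) t) i x)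
    <= Y * X ^ M * (Rabs x ^ (M - i) / INR (fact (M - i)))).
  { apply Derive_n_taylor_remainder; [exact Hi|apply Ck_trig|].
    intros y; apply Derive_n_trig_bound. }
  (* Of this weight, [N] powers are those to be estimated and [M - i] absorb the growth of the
     differentiated Taylor remainder. *)
  assert (H2 := HC j ltac:(lia) (N + (M - i))%nat x).
  assert (H3 := fact_plus_le (M - i) q).
  replace (N + (M - i) + p)%nat with (M - i + q)%nat in H2 by (unfold q; lia).
  set (n := (M - i)%nat) in *.
  rewrite !(pow_add _ N n) in H2; fold w in H2.
  rewrite pow_add in H3.
  assert (HF := INR_fact_lt_0 n); assert (HFq := INR_fact_lt_0 q).
  apply (Rmult_le_reg_l w); [exact Hw|].
  replace (w * (E * (/ 2) ^ M / w)) with (E * (/ 2) ^ M) by (field; lra).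
  set (d := Rabs (Derive_n u j x)) in *.
  assert (d0 : 0 <= d) by apply Rabs_pos.
  assert (Hx : 0 <= Rabs x) by apply Rabs_pos.
  assert (H4 : Rabs x ^ n <= (1 + Rabs x) ^ n) by (apply pow_incr; lra).
  assert (H5 : 0 <= X ^ M) by now apply pow_le.
  apply Rle_trans with
    (Y * X ^ M / INR (fact n) * (w * (1 + Rabs x) ^ n * d)).
  { apply Rle_trans with
      (w * (Y * X ^ M * (Rabs x ^ n / INR (fact n)) * d)).
    - apply Rmult_le_compat_l; [lra|]; now apply Rmult_le_compat_r.
    - replace (w * (Y * X ^ M * (Rabs x ^ n / INR (fact n)) * d)) with
        (Y * X ^ M / INR (fact n) * (w * Rabs x ^ n * d)) by (field; lra).
      apply Rmult_le_compat_l.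
      + apply Rmult_le_pos; [now apply Rmult_le_pos|].
        apply Rlt_le, Rinv_0_lt_compat, HF.
      + apply Rmult_le_compat_r; [exact d0|].
        apply Rmult_le_compat_l; lra. }
  apply Rle_trans with (Y * X ^ M / INR (fact n) *
    (C * (A ^ N * A ^ n * (2 ^ n * 2 ^ q * INR (fact n) * INR (fact q))))).
  { apply Rmult_le_compat_l.
    - apply Rmult_le_pos; [now apply Rmult_le_pos|].
      apply Rlt_le, Rinv_0_lt_compat, HF.
    - eapply Rle_trans; [exact H2|].
      apply Rmult_le_compat_l; [exact C0|].
      apply Rmult_le_compat_l; [|exact H3].
      apply Rmult_le_pos; apply pow_le; lra. }
  replace M with (i + n)%nat at 1 2 by (unfold n; lia).
  rewrite !pow_add.
  assert (H6 : X ^ i <= (1 + X) ^ N).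
  { apply Rle_trans with ((1 + X) ^ i); [apply pow_incr; lra|].
    apply Rle_pow; [lra|lia]. }
  assert (H7 : (2 * A * X) ^ n <= (/ 2) ^ n).
  { apply pow_incr; split; [|nra].
    apply Rmult_le_pos; lra. }
  (* The geometric gain has exponent [n = M - i] only; the factor [2 ^ N] in [E] pays for the [i]
     missing halves. *)
  assert (H8 : 1 <= 2 ^ N * (/ 2) ^ i).
  { rewrite pow_inv.
    assert (Hi2 := pow_lt 2 i Rlt_0_2).
    apply (Rmult_le_reg_r (2 ^ i)); [exact Hi2|].
    rewrite Rmult_assoc, Rinv_l, Rmult_1_l, Rmult_1_r by lra.
    apply Rle_pow; [lra|lia]. }
  replace (Y * (X ^ i * X ^ n) / INR (fact n) *
    (C * (A ^ N * A ^ n * (2 ^ n * 2 ^ q * INR (fact n) * INR (fact q)))))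
    with (Y * C * A ^ N * 2 ^ q * INR (fact q) * (X ^ i * (2 * A * X) ^ n))
    by (rewrite !Rpow_mult_distr; field; lra).
  replace (E * ((/ 2) ^ i * (/ 2) ^ n)) with
    (Y * C * A ^ N * 2 ^ q * INR (fact q) *
      ((1 + X) ^ N * (2 ^ N * (/ 2) ^ i * (/ 2) ^ n))) by (unfold E; ring).
  apply Rmult_le_compat_l.
  { repeat apply Rmult_le_pos; try apply pos_INR; try apply pow_le; lra. }
  apply Rmult_le_compat; [now apply pow_le| |exact H6|].
  + apply pow_le; repeat apply Rmult_le_pos; lra.
  + assert (H9 : 0 <= (/ 2) ^ n) by (apply pow_le; lra).
    nra.
- replace (w * (2 ^ m * (E * (/ 2) ^ M / w))) with (2 ^ m * (E * (/ 2) ^ M))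
    by (field; lra).
  eapply Rle_trans; [|exact HM].
  apply Rmult_le_compat_r; [apply Rmult_le_pos; [exact E0|apply pow_le; lra]|].
  apply Rle_pow; [lra|lia].
Qed.

Lemma admissible_trig_small a b xi u : 4 * (A * Rabs xi) <= 1 ->
  admissible V A u -> admissible V A (fun x => trig a b xi x * u x).
Proof.
intros Hxi Hu; split.
- destruct (proj1 Hu) as [p Hp]; exists p.
  apply fact_decay_trig; [exact HA| |exact Hp].
  now apply admissible_Ck.
- intros n.
  replace (fun x => x ^ n * (trig a b xi x * u x)) with
    (fun x => trig a b xi x * (x ^ n * u x))
    by (apply functional_extensionality; intros; ring).
  now apply V_trig, admissible_pow.
Qed.

Lemma admissible_trig a b xi u :
  admissible V A u -> admissible V A (fun x => trig a b xi x * u x).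
Proof.
(* The frequency [n * eta] is reached in [n] steps of size [eta]. The smallness condition involves
   only [A], which each step preserves. *)
assert (H : forall eta, 4 * (A * Rabs eta) <= 1 -> forall n a b u,
  admissible V A u -> admissible V A (fun x => trig a b (INR n * eta) x * u x)).
{ clear a b u; intros eta Heta n; induction n as [|n IH]; intros a b u Hu.
  - replace (fun x => trig a b (INR 0 * eta) x * u x) with (fun x => a * u x);
      [now apply admissible_scal|].
    apply functional_extensionality; intros x; unfold trig; simpl INR.
    rewrite !Rmult_0_l, cos_0, sin_0; ring.
  - replace (fun x => trig a b (INR (S n) * eta) x * u x) with
      (fun x => trig a b (INR n * eta) x * (trig 1 0 eta x * u x) +
                trig b (- a) (INR n * eta) x * (trig 0 1 eta x * u x)).
    + apply admissible_plus; now apply IH, admissible_trig_small.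
    + apply functional_extensionality; intros x; unfold trig; rewrite S_INR.
      replace ((INR n + 1) * eta * x) with (INR n * eta * x + eta * x) by ring.
      rewrite cos_plus, sin_plus; ring. }
intros Hu.
destruct (nfloor_ex (4 * (A * Rabs xi))) as [n [_ Hn]].
{ repeat apply Rmult_le_pos; try lra; apply Rabs_pos. }
assert (Hn0 : 0 < INR (S n)) by (apply lt_0_INR; lia).
replace xi with (INR (S n) * (xi / INR (S n))) by (field; lra).
apply H; [|exact Hu].
unfold Rdiv; rewrite Rabs_mult, Rabs_inv, (Rabs_pos_eq (INR (S n))) by lra.
apply (Rmult_le_reg_r (INR (S n))); [exact Hn0|].
replace (4 * (A * (Rabs xi * / INR (S n))) * INR (S n)) with (4 * (A * Rabs xi))
  by (field; lra).
rewrite S_INR; lra.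
Qed.

Lemma Rmult_RInt (f : R -> R) a b k : (forall x, continuous f x) ->
  k * RInt f a b = RInt (fun x => k * f x) a b.
Proof.
intros Hf; symmetry; apply (RInt_scal f a b k).
apply (@ex_RInt_continuous R_CompleteNormedModule); intros; apply Hf.
Qed.

Lemma Rplus_RInt (f g : R -> R) a b :
  (forall x, continuous f x) -> (forall x, continuous g x) ->
  RInt f a b + RInt g a b = RInt (fun x => f x + g x) a b.
Proof.
intros Hf Hg; symmetry; apply (RInt_plus f g a b);
  apply (@ex_RInt_continuous R_CompleteNormedModule); intros; [apply Hf|apply Hg].
Qed.

Lemma continuous_cos_pow a n x y : continuous (fun y => cos (a * (x - y)) ^ n) y.
Proof.
apply (ex_derive_continuous (fun y => cos (a * (x - y)) ^ n)).
auto_derive; exact I.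
Qed.

(** The integral need not be approximated by sums. Expanding one factor [cos (a x - a y)] separates
    the variables: the functions of [y] join [g] and those of [x] join [u]. After [n] such steps the
    integral is a constant. *)
Lemma admissible_convolution a L n (g u : R -> R) : (forall y, continuous g y) ->
  admissible V A u ->
  admissible V A (fun x => RInt (fun y => g y * cos (a * (x - y)) ^ n) (- L) L * u x).
Proof.
revert g u; induction n as [|n IH]; intros g u Hg Hu.
- simpl; now apply admissible_scal.
- assert (Hc : forall y, continuous (fun y => g y * cos (a * y)) y).
  { intros y; apply (continuous_mult g); [apply Hg|].
    apply (ex_derive_continuous (fun y => cos (a * y))); auto_derive; exact I. }
  assert (Hs : forall y, continuous (fun y => g y * sin (a * y)) y).
  { intros y; apply (continuous_mult g); [apply Hg|].
    apply (ex_derive_continuous (fun y => sin (a * y))); auto_derive; exact I. }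
  replace (fun x => RInt (fun y => g y * cos (a * (x - y)) ^ S n) (- L) L * u x) with
    (fun x =>
      RInt (fun y => g y * cos (a * y) * cos (a * (x - y)) ^ n) (- L) L *
        (trig 1 0 a x * u x) +
      RInt (fun y => g y * sin (a * y) * cos (a * (x - y)) ^ n) (- L) L *
        (trig 0 1 a x * u x)).
  + apply admissible_plus; apply IH; try assumption; now apply admissible_trig.
  + apply functional_extensionality; intros x.
    rewrite <- !Rmult_assoc, <- Rmult_plus_distr_r; f_equal.
    rewrite !(Rmult_comm (RInt _ _ _)).
    assert (Hc' : forall y, continuous
      (fun y => g y * cos (a * y) * cos (a * (x - y)) ^ n) y).
    { intros y; apply (continuous_mult (fun y => g y * cos (a * y)));
        [apply Hc|apply continuous_cos_pow]. }
    assert (Hs' : forall y, continuous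
      (fun y => g y * sin (a * y) * cos (a * (x - y)) ^ n) y).
    { intros y; apply (continuous_mult (fun y => g y * sin (a * y)));
        [apply Hs|apply continuous_cos_pow]. }
    rewrite !Rmult_RInt by assumption.
    rewrite Rplus_RInt by (intros y;
      (apply (continuous_scal_r (K := R_AbsRing) (V := R_NormedModule)));
      apply Hc' || apply Hs').
    apply RInt_ext; intros y _; unfold trig; simpl.
    replace (a * (x - y)) with (a * x - a * y) by ring.
    rewrite (cos_minus (a * x) (a * y)) at 3; ring.
Qed.

End Admissible.

(** * Periodic convolution *)

Definition convolution (L : R) (K g : R -> R) (x : R) : R :=
  RInt (fun y => g y * K (x - y)) (- L) L.

Lemma continuous_conv_integrand (K g : R -> R) x : Ck 0 K -> Ck 0 g ->
  forall y, continuous (fun y => g y * K (x - y)) y.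
Proof.
intros HK Hg y; apply (continuous_mult g); [apply Hg|].
apply (continuous_comp (fun y => x - y) K); [|apply HK].
apply (continuous_minus (fun _ => x)); [apply continuous_const|apply continuous_id].
Qed.

(* Differentiating under the integral hits [K]; integration by parts moves the
   derivative to [g], and the boundary terms cancel by periodicity of [K]. *)
Lemma is_derive_convolution L K g x : Ck 1 K -> Ck 1 g ->
  (forall t, K (t + L) = K (t - L)) -> g (- L) = g L ->
  is_derive (convolution L K g) x (convolution L K (Derive g) x).
Proof.
intros HK Hg Hper Hbd.
assert (HK0 := Ck_pred 0 _ HK); assert (Hg0 := Ck_pred 0 _ Hg).
destruct HK as [HK1 HK2], Hg as [Hg1 Hg2].
assert (D : forall t u, is_derive (fun u => g t * K (u - t)) u (g t * Derive K (u - t))).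
{ intros t u; apply is_derive_scal.
  replace (Derive K (u - t)) with (1 * Derive K (u - t)) by ring.
  apply (is_derive_comp K); [now apply Derive_correct|].
  auto_derive; [exact I|ring]. }
assert (E : convolution L K (Derive g) x =
  RInt (fun t => Derive (fun u => g t * K (u - t)) x) (- L) L).
{ transitivity (RInt (fun t => g t * Derive K (x - t)) (- L) L).
  - assert (P : is_RInt (fun y => Derive g y * K (x - y) - g y * Derive K (x - y))
      (- L) L (g L * K (x - L) - g (- L) * K (x - - L))).
    { apply (is_RInt_derive (fun y => g y * K (x - y))).
      - intros y _.
        replace (Derive g y * K (x - y) - g y * Derive K (x - y)) with
          (Derive g y * K (x - y) + g y * (-1 * Derive K (x - y))) by ring.
        apply (is_derive_mult g (fun y => K (x - y))).
        + now apply Derive_correct.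
        + apply (is_derive_comp K); [now apply Derive_correct|].
          auto_derive; [exact I|ring].
        + apply Rmult_comm.
      - intros y _; apply (continuous_minus (fun y => Derive g y * K (x - y)));
          now apply continuous_conv_integrand. }
    replace (x - - L) with (x + L) in P by ring.
    rewrite Hper, Hbd, Rminus_diag in P.
    apply (@is_RInt_unique R_CompleteNormedModule) in P.
    rewrite (RInt_minus (fun y => Derive g y * K (x - y))) in P;
      try (apply (@ex_RInt_continuous R_CompleteNormedModule); intros y _;
        now apply continuous_conv_integrand).
    now apply Rminus_diag_uniq.
  - apply RInt_ext; intros t _; symmetry; apply is_derive_unique, D. }
rewrite E.
apply (is_derive_RInt_param (fun u t => g t * K (u - t))).
- apply filter_forall; intros u t _; eexists; apply D.
- intros t _.
  apply continuity_2d_pt_ext with (fun u v => g v * Derive K (u - v)).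
  { intros u v; symmetry; apply is_derive_unique, D. }
  apply continuity_2d_pt_mult.
  + apply (continuity_1d_2d_pt_comp g (fun _ v => v)); [|apply continuity_2d_pt_id2].
    apply continuity_pt_filterlim, Hg0.
  + apply (continuity_1d_2d_pt_comp (Derive K) (fun u v => u - v)).
    * apply continuity_pt_filterlim, HK2.
    * apply continuity_2d_pt_minus; [apply continuity_2d_pt_id1|apply continuity_2d_pt_id2].
- apply filter_forall; intros u; apply (@ex_RInt_continuous R_CompleteNormedModule).
  intros y _; now apply continuous_conv_integrand.
Qed.

Lemma Derive_convolution L K g : Ck 1 K -> Ck 1 g ->
  (forall t, K (t + L) = K (t - L)) -> g (- L) = g L ->
  Derive (convolution L K g) = convolution L K (Derive g).
Proof.
intros; apply functional_extensionality; intros x.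
now apply is_derive_unique, is_derive_convolution.
Qed.

(** Since derivatives pass to [g], approximating the derivatives of [g] reduces to approximating
    functions by convolution with the same kernel. *)
Lemma Derive_n_convolution L K : Ck 1 K -> (forall t, K (t + L) = K (t - L)) ->
  forall n g, Ck (S n) g ->
  (forall j, (j <= n)%nat -> Derive_n g j (- L) = Derive_n g j L) ->
  Ck n (convolution L K g) /\ forall j, (j <= n)%nat ->
    Derive_n (convolution L K g) j = convolution L K (Derive_n g j).
Proof.
intros HK Hper n; induction n as [|n IH]; intros g Hg Hbd;
  assert (Hg1 : Ck 1 g) by (eapply Ck_le; [|exact Hg]; lia);
  assert (Hbd0 := Hbd 0%nat ltac:(lia)).
- split.
  + intros x; apply (ex_derive_continuous (convolution L K g)).
    eexists; now apply is_derive_convolution.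
  + intros j Hj; now replace j with 0%nat by lia.
- destruct (IH (Derive g)) as [IH1 IH2].
  { apply Hg. }
  { intros j Hj; rewrite Derive_n_Derive; apply Hbd; lia. }
  split.
  + split; [|now rewrite Derive_convolution].
    intros x; eexists; now apply is_derive_convolution.
  + intros [|j] Hj; [reflexivity|].
    rewrite <- !Derive_n_Derive, Derive_convolution by assumption.
    apply IH2; lia.
Qed.

(** The derivative of this mass is the convolution of [K] with 0. Hence one constant normalizes the
    kernel at all points, and it can be estimated at a convenient one. *)
Lemma convolution_1 L K : Ck 1 K -> (forall t, K (t + L) = K (t - L)) ->
  forall x y, convolution L K (fun _ => 1) x = convolution L K (fun _ => 1) y.
Proof.
intros HK Hper x y; apply Rminus_diag_uniq.
assert (D : forall x, is_derive (convolution L K (fun _ => 1)) x 0).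
{ intros t; replace 0 with (convolution L K (Derive (fun _ => 1)) t).
  - apply is_derive_convolution; try assumption; [apply Ck_const|reflexivity].
  - unfold convolution; rewrite (RInt_ext _ (fun _ => 0)).
    + rewrite RInt_const; apply Rmult_0_r.
    + intros; rewrite Derive_const; apply Rmult_0_l. }
apply Rabs_eq_0, Rle_antisym; [|apply Rabs_pos].
rewrite <- (Rmult_0_l (Rabs (x - y))).
apply Lipschitz_of_Derive.
- intros t; eexists; apply D.
- intros t; rewrite (is_derive_unique _ _ _ (D t)), Rabs_R0; apply Rle_refl.
Qed.

Lemma RInt_abs_le (f g : R -> R) a b : a <= b ->
  (forall x, continuous f x) -> (forall x, continuous g x) ->
  (forall x, a <= x <= b -> Rabs (f x) <= g x) -> Rabs (RInt f a b) <= RInt g a b.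
Proof.
intros Hab Hf Hg H.
apply (norm_RInt_le f g a b); [exact Hab|exact H| |];
  apply (@RInt_correct R_CompleteNormedModule);
  apply (@ex_RInt_continuous R_CompleteNormedModule); intros; [apply Hf|apply Hg].
Qed.

Lemma convolution_bound L K h M x : 0 < L -> Ck 0 K -> Ck 0 h ->
  (forall t, 0 <= K t) -> (forall t, Rabs (h t) <= M) ->
  Rabs (convolution L K h x) <= M * convolution L K (fun _ => 1) x.
Proof.
intros HL HK Hh K0 HM; unfold convolution.
rewrite Rmult_RInt
  by (apply (continuous_conv_integrand K (fun _ => 1)); [exact HK|apply (Ck_const 0)]).
apply RInt_abs_le; [lra|now apply continuous_conv_integrand| |].
- intros y; apply (continuous_scal_r (K := R_AbsRing) (V := R_NormedModule)).
  apply (continuous_conv_integrand K (fun _ => 1)); [exact HK|apply (Ck_const 0)].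
- intros y _; rewrite Rabs_mult, (Rabs_pos_eq (K _)), Rmult_1_l by apply K0.
  now apply Rmult_le_compat_r.
Qed.

(** For [|x - y| <= delta] the Lipschitz bound applies; elsewhere the integrand is at most [2 M Q]
    on an interval of length [2 L]. The range up to [3 L / 2] comes from [|x| <= L / 2] and
    [|y| <= L]; it stays short of the next peak of a kernel of period [2 L]. *)
Lemma convolution_approx L K h M delta Q x : 0 < L -> 0 < delta -> Ck 0 K -> Ck 0 h ->
  (forall t, 0 <= K t) -> (forall t, Rabs (h t) <= M) -> 0 <= Q ->
  (forall s t, Rabs (h t - h s) <= M * Rabs (t - s)) ->
  (forall t, delta <= Rabs t <= 3 * L / 2 -> K t <= Q) ->
  Rabs x <= L / 2 ->
  Rabs (convolution L K h x - h x * convolution L K (fun _ => 1) x) <=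
    M * delta * convolution L K (fun _ => 1) x + 4 * L * M * Q.
Proof.
intros HL Hdelta HK Hh K0 HM Q0 HLip HQ Hx.
assert (M0 : 0 <= M) by (eapply Rle_trans; [apply Rabs_pos|apply (HM 0)]).
assert (H1 : forall y, continuous (fun y => 1 * K (x - y)) y).
{ apply (continuous_conv_integrand K (fun _ => 1)); [exact HK|apply (Ck_const 0)]. }
assert (Hs : forall c y, continuous (fun y => c * (1 * K (x - y))) y).
{ intros c y; now apply (continuous_scal_r (K := R_AbsRing) (V := R_NormedModule)). }
replace (4 * L * M * Q) with (RInt (fun _ => 2 * M * Q) (- L) L)
  by (rewrite RInt_const; unfold scal; simpl; unfold mult; simpl; field).
replace (convolution L K h x - h x * convolution L K (fun _ => 1) x) with
  (convolution L K h x + - h x * convolution L K (fun _ => 1) x) by ring.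
unfold convolution; rewrite !Rmult_RInt by assumption.
rewrite !Rplus_RInt by (apply Hs || (intros; apply continuous_const) ||
  now apply continuous_conv_integrand).
apply RInt_abs_le; [lra| | |].
- intros y; apply (continuous_plus (fun y => h y * K (x - y)));
    [now apply continuous_conv_integrand|apply Hs].
- intros y; apply (continuous_plus (fun y => M * delta * (1 * K (x - y))));
    [apply Hs|apply continuous_const].
- intros y Hy.
  replace (h y * K (x - y) + - h x * (1 * K (x - y))) with
    ((h y - h x) * K (x - y)) by ring.
  rewrite Rabs_mult, (Rabs_pos_eq (K _)), Rmult_1_l by apply K0.
  assert (HK0 := K0 (x - y)).
  assert (Hd := Rabs_pos (h y - h x)).
  destruct (Rle_lt_dec (Rabs (x - y)) delta) as [Hxy|Hxy].
  + assert (Rabs (h y - h x) <= M * delta).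
    { eapply Rle_trans; [apply HLip|]; rewrite Rabs_minus_sym.
      now apply Rmult_le_compat_l. }
    assert (0 <= M * Q) by now apply Rmult_le_pos.
    nra.
  + assert (HKQ : K (x - y) <= Q).
    { apply HQ; split; [lra|].
      apply Rabs_le_between in Hx; apply Rabs_le; lra. }
    assert (Rabs (h y - h x) <= 2 * M).
    { eapply Rle_trans; [apply Rabs_triang|].
      rewrite Rabs_Ropp; generalize (HM x) (HM y); lra. }
    apply Rle_trans with (2 * M * Q); [now apply Rmult_le_compat|].
    enough (0 <= M * delta * K (x - y)) by lra.
    repeat apply Rmult_le_pos; lra.
Qed.

(** * Approximation by trigonometric polynomials *)

(** Take [r] strictly between [sqrt q] and 1, so that [q ^ n <= r ^ n * r ^ n]. One factor [r ^ n]
    offsets the linear term by Bernoulli's inequality, and the other tends to 0. *)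
Lemma linear_geometric_small q eps : 0 <= q < 1 -> 0 < eps ->
  exists n, (2 * INR n + 1) * q ^ n <= eps.
Proof.
intros Hq Heps.
set (r := (sqrt q + 1) / 2).
assert (Hs : sqrt q < 1) by (rewrite <- sqrt_1; apply sqrt_lt_1; lra).
assert (Hs0 := sqrt_pos q).
assert (Hr : 0 < r < 1) by (unfold r; lra).
assert (Hqr : q <= r * r).
{ rewrite <- (sqrt_sqrt q) by lra; unfold r; nra. }
set (eta := / r - 1).
assert (Her : (1 + eta) * r = 1) by (unfold eta; field; lra).
assert (Heta : 0 < eta) by nra.
destruct (pow_lt_1_zero r) with (y := eps / (2 / eta + 1)) as [n Hn].
- rewrite Rabs_pos_eq; lra.
- apply Rdiv_lt_0_compat; [exact Heps|].
  assert (0 < 2 / eta) by (apply Rdiv_lt_0_compat; lra); lra.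
- exists n; specialize (Hn n (le_n n)).
  assert (Hrn : 0 < r ^ n) by (apply pow_lt; lra).
  rewrite Rabs_pos_eq in Hn by lra.
  assert (Hb := poly n eta Heta).
  assert (H1 : (1 + INR n * eta) * r ^ n <= 1).
  { apply Rle_trans with ((1 + eta) ^ n * r ^ n).
    - apply Rmult_le_compat_r; lra.
    - rewrite <- Rpow_mult_distr, Her, pow1; lra. }
  assert (Hrn1 : r ^ n <= 1).
  { now rewrite <- (pow1 n); apply pow_incr; lra. }
  assert (H2 : (2 * INR n + 1) * r ^ n <= 2 / eta + 1).
  { apply (Rmult_le_reg_r eta); [exact Heta|].
    replace ((2 / eta + 1) * eta) with (2 + eta) by (field; lra).
    nra. }
  assert (H3 : q ^ n <= r ^ n * r ^ n).
  { rewrite <- Rpow_mult_distr; apply pow_incr; lra. }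
  assert (H0 : 0 < 2 / eta + 1).
  { assert (0 < 2 / eta) by (apply Rdiv_lt_0_compat; lra); lra. }
  apply (Rmult_lt_compat_l _ _ _ H0) in Hn.
  replace ((2 / eta + 1) * (eps / (2 / eta + 1))) with eps in Hn by (field; lra).
  assert (Hn0 := pos_INR n).
  apply Rle_trans with ((2 * INR n + 1) * (r ^ n * r ^ n)).
  + apply Rmult_le_compat_l; [lra|exact H3].
  + rewrite <- Rmult_assoc.
    apply Rle_trans with ((2 / eta + 1) * r ^ n); [|lra].
    apply Rmult_le_compat_r; lra.
Qed.

(** The cosine changes sign under a shift by [2 L]; the even exponent makes the kernel
    [2 L]-periodic and nonnegative. *)
Definition cos_kernel (L : R) (n : nat) (t : R) : R := cos (PI / (2 * L) * t) ^ (2 * n).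

Lemma Ck_cos_kernel m L n : Ck m (cos_kernel L n).
Proof.
apply (Ck_pow m (fun t => cos (PI / (2 * L) * t))).
replace (fun t => cos (PI / (2 * L) * t)) with (trig 1 0 (PI / (2 * L))).
- apply Ck_trig.
- apply functional_extensionality; intros t; unfold trig; ring.
Qed.

Lemma cos_kernel_pos L n t : 0 <= cos_kernel L n t.
Proof. unfold cos_kernel; rewrite pow_mult; apply pow_le, pow2_ge_0. Qed.

Lemma cos_kernel_periodic L n t : 0 < L ->
  cos_kernel L n (t + L) = cos_kernel L n (t - L).
Proof.
intros HL; unfold cos_kernel; rewrite !pow_mult; f_equal.
replace (PI / (2 * L) * (t + L)) with (PI / (2 * L) * (t - L) + PI) by (field; lra).
rewrite neg_cos; ring.
Qed.

(* At the point [L] the argument of the cosine ranges over [0, PI], where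
   [cos^(2n) >= cos^(2n) * sin], which has an explicit primitive. *)
Lemma cos_kernel_mass L n x : 0 < L ->
  4 * L / (PI * (2 * INR n + 1)) <= convolution L (cos_kernel L n) (fun _ => 1) x.
Proof.
intros HL; assert (HPI := PI_RGT_0); assert (Hn := pos_INR n).
assert (Ha : 0 < PI / (2 * L)) by (apply Rdiv_lt_0_compat; lra).
rewrite (convolution_1 L (cos_kernel L n) (Ck_cos_kernel 1 L n)
  (fun t => cos_kernel_periodic L n t HL) x L).
set (a := PI / (2 * L)) in *.
set (b := a * (2 * INR n + 1)).
assert (Hb : 0 < b) by (apply Rmult_lt_0_compat; lra).
assert (P : is_RInt (fun y => cos (a * (L - y)) ^ (2 * n) * sin (a * (L - y))) (- L) L
  (cos (a * (L - L)) ^ (2 * n + 1) / b - cos (a * (L - - L)) ^ (2 * n + 1) / b)).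
{ apply (is_RInt_derive (fun y => cos (a * (L - y)) ^ (2 * n + 1) / b)).
  - intros y _; auto_derive; [exact I|].
    replace (n + (n + 0) + 1)%nat with (2 * n + 1)%nat by lia.
    replace (pred (2 * n + 1)) with (2 * n)%nat by lia.
    rewrite plus_INR, mult_INR; simpl (INR 2); simpl (INR 1).
    unfold b, Rminus; field; lra.
  - intros y _.
    apply (ex_derive_continuous (fun y => cos (a * (L - y)) ^ (2 * n) * sin (a * (L - y)))).
    auto_derive; exact I. }
apply (@is_RInt_unique R_CompleteNormedModule) in P.
replace (a * (L - L)) with 0 in P by ring.
replace (a * (L - - L)) with PI in P by (unfold a; field; lra).
rewrite cos_0, cos_PI, pow1, Nat.add_1_r, pow_1_odd in P.
replace (4 * L / (PI * (2 * INR n + 1))) with (1 / b - -1 / b)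
  by (unfold b, a; field; repeat split; lra).
rewrite <- P; unfold convolution.
apply RInt_le; [lra| | |].
- apply (@ex_RInt_continuous R_CompleteNormedModule); intros y _.
  apply (ex_derive_continuous (fun y => cos (a * (L - y)) ^ (2 * n) * sin (a * (L - y)))).
  auto_derive; exact I.
- apply (@ex_RInt_continuous R_CompleteNormedModule); intros y _.
  apply (continuous_conv_integrand _ (fun _ => 1)); [apply Ck_cos_kernel|apply (Ck_const 0)].
- intros y Hy; rewrite Rmult_1_l; fold (cos_kernel L n (L - y)).
  assert (H := cos_kernel_pos L n (L - y)); unfold cos_kernel in *; fold a in H |- *.
  generalize (SIN_bound (a * (L - y))); nra.
Qed.

(** With [a = PI / (2 L)], one has [a delta <= PI / 4] and [a |t| <= 3 PI / 4], so [a |t|] lies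
    between [a delta] and [PI - a delta]. As the cosine decreases on [0, PI], its absolute value
    there is at most [cos (a delta)]. *)
Lemma cos_kernel_tail L n delta t : 0 < L -> 0 < delta <= L / 2 ->
  delta <= Rabs t <= 3 * L / 2 ->
  cos_kernel L n t <= (cos (PI / (2 * L) * delta) ^ 2) ^ n.
Proof.
intros HL Hd Ht; assert (HPI := PI_RGT_0).
unfold cos_kernel; rewrite pow_mult.
set (a := PI / (2 * L)).
assert (Ha : 0 < a) by (apply Rdiv_lt_0_compat; lra).
assert (HaL : a * L = PI / 2) by (unfold a; field; lra).
apply pow_incr; split; [apply pow2_ge_0|].
replace (cos (a * t)) with (cos (a * Rabs t)).
- assert (H0 : 0 <= cos (a * delta)).
  { apply cos_ge_0; nra. }
  assert (H1 : cos (a * Rabs t) <= cos (a * delta)) by (apply cos_decr_1; nra).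
  assert (H2 : - cos (a * delta) <= cos (a * Rabs t)).
  { replace (- cos (a * delta)) with (cos (PI - a * delta)).
    - apply cos_decr_1; nra.
    - rewrite Rtrigo_facts.cos_pi_minus; reflexivity. }
  nra.
- unfold Rabs; destruct (Rcase_abs t); [|reflexivity].
  rewrite <- cos_neg; f_equal; ring.
Qed.

Lemma trig_approximation N h a : Ck (S N) h -> (forall x, a < Rabs x -> h x = 0) ->
  forall eps, 0 < eps -> exists L n c, 0 < L /\
    Ck N (convolution L (cos_kernel L n) h) /\
    forall j, (j <= N)%nat -> forall x,
      Rabs (Derive_n (fun t => h t - c * convolution L (cos_kernel L n) h t) j x)
        <= eps * (1 + Rabs x).
Proof.
intros Hh Hsupp eps Heps; assert (HPI := PI_RGT_0).
destruct (Ck_support_bounded (S N) h a Hh Hsupp) as [M [M0 HM]].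
(* The first two terms put the support of [h] inside [(-L, L)], so boundary values vanish; the last
   gives [2 M <= eps * |x|] for [|x| > L / 2]. *)
set (L := Rabs a + 1 + 4 * M / eps).
assert (HMe : 0 <= 4 * M / eps).
{ apply Rmult_le_pos; [lra|]; now apply Rlt_le, Rinv_0_lt_compat. }
assert (HL : 0 < L) by (generalize (Rabs_pos a); unfold L; lra).
assert (HaL : a < L) by (generalize (Rle_abs a); unfold L; lra).
assert (HML : 4 * M <= eps * L).
{ replace (4 * M) with (eps * (4 * M / eps)) by (field; lra).
  apply Rmult_le_compat_l; [lra|]; generalize (Rabs_pos a); unfold L; lra. }
set (delta := Rmin (L / 2) (eps / (2 * (M + 1)))).
assert (Hd : 0 < delta <= L / 2).
{ split; [|apply Rmin_l].
  apply Rmin_glb_lt; [lra|apply Rdiv_lt_0_compat; lra]. }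
assert (HMd : M * delta <= eps / 2).
{ apply Rle_trans with (M * (eps / (2 * (M + 1)))).
  - apply Rmult_le_compat_l; [exact M0|apply Rmin_r].
  - apply (Rmult_le_reg_r (2 * (M + 1))); [lra|].
    replace (M * (eps / (2 * (M + 1))) * (2 * (M + 1))) with (M * eps) by (field; lra).
    nra. }
set (q := cos (PI / (2 * L) * delta) ^ 2).
assert (Hq : 0 <= q < 1).
{ assert (Ha : 0 < PI / (2 * L)) by (apply Rdiv_lt_0_compat; lra).
  assert (HaL2 : PI / (2 * L) * L = PI / 2) by (field; lra).
  split; [apply pow2_ge_0|].
  set (s := PI / (2 * L) * delta) in *.
  assert (Hs : 0 < s < PI) by (unfold s; nra).
  assert (H1 := sin_gt_0 s (proj1 Hs) (proj2 Hs)).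
  generalize (sin2_cos2 s); unfold q, Rsqr; fold s; simpl; nra. }
(* [n] is chosen after [L] and [delta], on which [q] depends. The linear factor is the inverse of
   the lower bound for the mass, up to a constant, so the tail stays small after normalization. The
   [+ 1] covers [M = 0]. *)
destruct (linear_geometric_small q (eps / (2 * (PI * M + 1)))) as [n Hn];
  [exact Hq|apply Rdiv_lt_0_compat; nra|].
set (K := cos_kernel L n).
assert (HK : forall m, Ck m K) by (intros; apply Ck_cos_kernel).
assert (HKper : forall t, K (t + L) = K (t - L))
  by (intros; now apply cos_kernel_periodic).
set (Z := convolution L K (fun _ => 1) 0).
assert (HZ : forall x, convolution L K (fun _ => 1) x = Z)
  by (intros; now apply convolution_1).
assert (Hn0 := pos_INR n).
assert (HZn : 4 * L <= Z * (PI * (2 * INR n + 1))).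
{ assert (Hp : 0 < PI * (2 * INR n + 1)) by (apply Rmult_lt_0_compat; lra).
  assert (H := cos_kernel_mass L n 0 HL); fold K Z in H.
  apply (Rmult_le_compat_r _ _ _ (Rlt_le _ _ Hp)) in H.
  replace (4 * L / (PI * (2 * INR n + 1)) * (PI * (2 * INR n + 1))) with (4 * L) in H
    by (field; lra).
  exact H. }
assert (HZ0 : 0 < Z).
{ apply (Rmult_lt_reg_r (PI * (2 * INR n + 1))); [apply Rmult_lt_0_compat|]; lra. }
assert (Hqn : 0 <= q ^ n) by (apply pow_le; lra).
assert (Hq2 : 4 * L * M * q ^ n <= eps / 2 * Z).
{ apply Rle_trans with (Z * (PI * (2 * INR n + 1)) * (M * q ^ n)).
  - rewrite Rmult_assoc; apply Rmult_le_compat_r; [now apply Rmult_le_pos|exact HZn].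
  - replace (Z * (PI * (2 * INR n + 1)) * (M * q ^ n)) with
      (Z * (PI * M * ((2 * INR n + 1) * q ^ n))) by ring.
    rewrite (Rmult_comm (eps / 2)); apply Rmult_le_compat_l; [lra|].
    assert (0 <= PI * M) by (apply Rmult_le_pos; lra).
    apply Rle_trans with (PI * M * (eps / (2 * (PI * M + 1)))).
    + now apply Rmult_le_compat_l.
    + apply (Rmult_le_reg_r (2 * (PI * M + 1))); [lra|].
      replace (PI * M * (eps / (2 * (PI * M + 1))) * (2 * (PI * M + 1)))
        with (PI * M * eps) by (field; lra).
      nra. }
destruct (Derive_n_convolution L K (HK 1%nat) HKper N h Hh) as [HC HD].
{ intros j Hj; rewrite !(Derive_n_support h a Hsupp); [reflexivity| |].
  - rewrite Rabs_pos_eq; lra.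
  - rewrite Rabs_Ropp, Rabs_pos_eq; lra. }
exists L, n, (/ Z); split; [exact HL|split; [exact HC|]].
intros j Hj x; fold K.
rewrite (Derive_n_minus_Ck j N); [|exact Hj|now apply Ck_pred|
  apply Ck_mult; [apply Ck_const|exact HC]].
rewrite Derive_n_scal_l, HD by exact Hj.
assert (Hh0 : Ck 1 (Derive_n h j)) by (apply Ck_Derive_n, (Ck_le (S N)); [lia|exact Hh]).
assert (Hb : forall t, Rabs (Derive_n h j t) <= M) by (apply HM; lia).
set (g := Derive_n h j) in *.
assert (Hx := Rabs_pos x).
destruct (Rle_lt_dec (Rabs x) (L / 2)) as [HxL|HxL].
- assert (H := convolution_approx L K g M delta (q ^ n) x HL (proj1 Hd) (HK 0%nat)
    (Ck_pred 0 _ Hh0) (cos_kernel_pos L n) Hb Hqn).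
  rewrite HZ in H.
  assert (H1 : Rabs (convolution L K g x - g x * Z) <= eps * Z).
  { eapply Rle_trans; [apply H|].
    (* The Lipschitz constant of the [j]-th derivative is the bound on the next one, which is why
       [h] has class C^(N+1). *)
    - intros s t; apply Lipschitz_of_Derive; [apply Hh0|].
      apply (HM (S j)); lia.
    - intros t; apply cos_kernel_tail; [exact HL|exact Hd].
    - exact HxL.
    - apply (Rmult_le_compat_r Z) in HMd; lra. }
  replace (g x - / Z * convolution L K g x) with
    (- / Z * (convolution L K g x - g x * Z)) by (field; lra).
  rewrite Rabs_mult, Rabs_Ropp, (Rabs_pos_eq (/ Z))
    by (now apply Rlt_le, Rinv_0_lt_compat).
  apply Rle_trans with (/ Z * (eps * Z)).
  + apply Rmult_le_compat_l; [now apply Rlt_le, Rinv_0_lt_compat|exact H1].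
  + replace (/ Z * (eps * Z)) with eps by (field; lra); nra.
- assert (H := convolution_bound L K g M x HL (HK 0%nat) (Ck_pred 0 _ Hh0)
    (cos_kernel_pos L n) Hb).
  rewrite HZ in H.
  assert (H1 : Rabs (/ Z * convolution L K g x) <= M).
  { rewrite Rabs_mult, (Rabs_pos_eq (/ Z)) by (now apply Rlt_le, Rinv_0_lt_compat).
    apply (Rmult_le_reg_l Z); [exact HZ0|].
    rewrite <- Rmult_assoc, Rinv_r by lra; lra. }
  assert (H2 := Hb x).
  unfold Rminus; eapply Rle_trans; [apply Rabs_triang|]; rewrite Rabs_Ropp.
  nra.
Qed.

(** * Density and tempered distributions *)

(** The linear growth allowed to [r] is paid for by one additional weight on [u]. *)
Lemma rschwartz_mult_small N r u e M : Ck N r -> is_rschwartz u -> 0 <= e ->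
  (forall j, (j <= N)%nat -> forall x, Rabs (Derive_n r j x) <= e * (1 + Rabs x)) ->
  (forall j, (j <= N)%nat -> forall x, (1 + Rabs x) ^ S N * Rabs (Derive_n u j x) <= M) ->
  forall m x, (m <= N)%nat ->
    (1 + Rabs x) ^ N * Rabs (Derive_n (fun t => r t * u t) m x) <= 2 ^ N * e * M.
Proof.
intros Hr Hu He Hrb Hub m x Hm.
assert (Hw := weight_pos N x); assert (Hx := Rabs_pos x).
set (w := (1 + Rabs x) ^ N) in *.
assert (HM : 0 <= M).
{ eapply Rle_trans; [|apply (Hub 0%nat ltac:(lia) x)].
  apply Rmult_le_pos; [apply Rlt_le, weight_pos|apply Rabs_pos]. }
apply Rle_trans with (w * (2 ^ m * (e * M / w))).
- apply Rmult_le_compat_l; [lra|].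
  apply Derive_n_mult_bound; [now apply (Ck_le N)|now apply is_rschwartz_Ck|].
  intros i j Hij.
  assert (H1 := Hrb i ltac:(lia) x); assert (H2 := Hub j ltac:(lia) x).
  change ((1 + Rabs x) ^ S N) with ((1 + Rabs x) * w) in H2.
  apply (Rmult_le_reg_r w); [exact Hw|].
  replace (e * M / w * w) with (e * M) by (field; lra).
  set (d := Rabs (Derive_n u j x)) in *.
  assert (Hd : 0 <= d) by apply Rabs_pos.
  apply Rle_trans with (e * (1 + Rabs x) * d * w).
  + apply Rmult_le_compat_r; [lra|]; now apply Rmult_le_compat_r.
  + replace (e * (1 + Rabs x) * d * w) with (e * ((1 + Rabs x) * w * d)) by ring.
    now apply Rmult_le_compat_l.
- replace (w * (2 ^ m * (e * M / w))) with (2 ^ m * (e * M)) by (field; lra).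
  rewrite Rmult_assoc; apply Rmult_le_compat_r; [now apply Rmult_le_pos|].
  apply Rle_pow; [lra|exact Hm].
Qed.

Lemma rschwartz_common_bound u k n : is_rschwartz u ->
  exists M, 0 <= M /\ forall j, (j <= n)%nat -> forall x,
    (1 + Rabs x) ^ k * Rabs (Derive_n u j x) <= M.
Proof.
intros [_ Hu].
apply (common_bound (fun j M =>
  forall x, (1 + Rabs x) ^ k * Rabs (Derive_n u j x) <= M)); [|intros i; apply Hu].
intros i M M' HM H x; eapply Rle_trans; [apply H|exact HM].
Qed.

Theorem polynomial_multiples_dense V A p u : closed_subspace V -> 0 < A ->
  (forall x, 0 < u x) -> fact_decay A p u -> (forall n, V (fun x => x ^ n * u x)) ->
  forall g, is_rschwartz g -> V g.
Proof.
intros HV HA Hpos Hdec Hmom g Hg.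
assert (Hadm : admissible V A u) by (split; [now exists p|exact Hmom]).
assert (Hu := cs_rschwartz V HV u (admissible_V V A u Hadm)).
apply (cs_lim V HV); [exact Hg|]; intros N eps Heps.
destruct (rschwartz_common_bound g (S N) N Hg) as [M1 [M10 HM1]].
destruct (rschwartz_common_bound u (S N) N Hu) as [M2 [M20 HM2]].
assert (H2N := pow_lt 2 N Rlt_0_2).
set (e := eps / (2 ^ N * (M1 + M2 + 1))).
assert (HD : 0 < 2 ^ N * (M1 + M2 + 1)) by (apply Rmult_lt_0_compat; lra).
assert (He : 0 < e) by now apply Rdiv_lt_0_compat.
assert (Hee : 2 ^ N * e * M1 + 2 ^ N * e * M2 <= eps).
{ replace eps with (e * (2 ^ N * (M1 + M2 + 1))) by (unfold e; field; lra).
  assert (0 < e * 2 ^ N) by now apply Rmult_lt_0_compat.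
  nra. }
destruct (cutoff_exists (S N) e He) as (chi & a & Hchi & Hsupp & Hchib).
set (h := fun x => chi x * (g x * / u x)).
assert (Hh : Ck (S N) h).
{ apply Ck_mult; [exact Hchi|apply Ck_mult; [now apply is_rschwartz_Ck|]].
  apply Ck_inv; [|now apply is_rschwartz_Ck].
  intros x; generalize (Hpos x); lra. }
assert (Hhs : forall x, a < Rabs x -> h x = 0).
{ intros x Hx; unfold h; rewrite (Hsupp x Hx); ring. }
destruct (trig_approximation N h a Hh Hhs e He) as (L & n & c & HL & HC & Hb).
set (w := convolution L (cos_kernel L n) h) in *.
exists (fun x => c * (w x * u x)); split.
{ apply (cs_scal V HV), (admissible_V V A).
  apply (admissible_convolution V A HV HA); [|exact Hadm].
  now apply (Ck_continuous (S N)). }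
intros m x Hm.
assert (H1chi : Ck N (fun t => 1 - chi t))
  by (apply Ck_minus; [apply Ck_const|now apply Ck_pred]).
assert (Hhw : Ck N (fun t => h t - c * w t)).
{ apply Ck_minus; [now apply Ck_pred|].
  apply Ck_mult; [apply Ck_const|exact HC]. }
(* As [h * u = chi * g], the error splits into a cutoff part, controlled by the decay of [g], and an
   approximation part, controlled by that of [u]. *)
replace (fun t => g t - c * (w t * u t)) with
  (fun t => (1 - chi t) * g t + (h t - c * w t) * u t).
2: { apply functional_extensionality; intros t; unfold h.
     field; generalize (Hpos t); lra. }
rewrite (Derive_n_plus (fun t => (1 - chi t) * g t));
  try (apply filter_forall; intros y k Hk; apply (Ck_ex_derive_n N); [lia|];
    apply Ck_mult; [assumption|now apply is_rschwartz_Ck]).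
assert (B1 := rschwartz_mult_small N _ g e M1 H1chi Hg (Rlt_le _ _ He)
  (fun j Hj => Hchib j (Nat.le_le_succ_r _ _ Hj)) HM1 m x Hm).
assert (B2 := rschwartz_mult_small N _ u e M2 Hhw Hu (Rlt_le _ _ He) Hb HM2 m x Hm).
eapply Rle_trans; [|exact Hee].
eapply Rle_trans; [|exact (Rplus_le_compat _ _ _ _ B1 B2)].
rewrite <- Rmult_plus_distr_l; apply Rmult_le_compat_l; [|apply Rabs_triang].
apply Rlt_le, weight_pos.
Qed.

(** * Reduction of tempered distributions to real test functions *)

Lemma is_schwartz_of_real u : is_rschwartz u -> is_schwartz (fun x => RtoC (u x)).
Proof.
intros Hu; apply is_schwartzE; split; [exact Hu|].
apply is_rschwartz_ext with (fun x => 0 * u x); [intros x; simpl; ring|].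
now apply is_rschwartz_scal.
Qed.

Definition schwartz_of_real (u : R -> R) (Hu : is_rschwartz u) : schwartz :=
  Schwartz _ (is_schwartz_of_real u Hu).

Lemma schwartz_real_imag (f : schwartz)
  (Hr : is_rschwartz (fun x => Re (f x))) (Hi : is_rschwartz (fun x => Im (f x))) :
  f = plus (schwartz_of_real _ Hr) (scal Ci (schwartz_of_real _ Hi)).
Proof.
apply schwartz_eq; intros x; simpl.
destruct (f x) as [a b]; apply injective_projections; simpl; ring.
Qed.

Lemma seminorm_minus_of_real k m u v Hu Hv M :
  (forall x, (1 + Rabs x) ^ k * Rabs (Derive_n (fun t => u t - v t) m x) <= M) ->
  Rbar_le (seminorm k m (minus (schwartz_of_real v Hv) (schwartz_of_real u Hu))) M.
Proof.
intros H; apply seminorm_le; intros x.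
eapply Rle_trans; [|apply (H x)].
apply Rmult_le_compat_l; [apply Rlt_le, weight_pos|].
unfold CDerive_n.
replace (fun t => Re (minus (schwartz_of_real v Hv) (schwartz_of_real u Hu) t))
  with (fun t => -1 * (u t - v t)).
2: { apply functional_extensionality; intros t; simpl; ring. }
replace (fun t => Im (minus (schwartz_of_real v Hv) (schwartz_of_real u Hu) t))
  with (fun t => 0 * u t).
2: { apply functional_extensionality; intros t; simpl; ring. }
rewrite !Derive_n_scal_l, Rmult_0_l.
change (Cmod (RtoC (-1 * Derive_n (fun t => u t - v t) m x)) <=
  Rabs (Derive_n (fun t => u t - v t) m x)).
rewrite Cmod_R, Rabs_mult, (Rabs_left (-1)) by lra; lra.
Qed.

Lemma eq_of_common_approx a b :
  (forall eps, 0 < eps -> exists c, Rabs (c - a) < eps /\ Rabs (c - b) < eps) -> a = b.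
Proof.
intros H; apply Rminus_diag_uniq, Rabs_eq_0, Rle_antisym; [|apply Rabs_pos].
apply le_epsilon; intros eps Heps; rewrite Rplus_0_l.
destruct (H (eps / 2) ltac:(lra)) as [c [Ha Hb]].
replace (a - b) with (c - b - (c - a)) by ring.
eapply Rle_trans; [apply Rabs_triang|]; rewrite Rabs_Ropp; lra.
Qed.

(** A test function carries its proof of being Schwartz; the existential quantifier turns agreement
    into a predicate on bare real functions, and proof irrelevance makes the witness immaterial. *)
Definition agree (T1 T2 : tempered_distribution) (u : R -> R) : Prop :=
  exists Hu : is_rschwartz u, T1 (schwartz_of_real u Hu) = T2 (schwartz_of_real u Hu).

Lemma td_approx (T : tempered_distribution) (f : schwartz) eps : 0 < eps ->
  exists N d, 0 < d /\ forall g : schwartz,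
    (forall k m, (k <= N)%nat -> (m <= N)%nat -> Rbar_lt (seminorm k m (minus g f)) d) ->
    Rabs (fst (T g) - fst (T f)) < eps /\ Rabs (snd (T g) - snd (T f)) < eps.
Proof.
intros Heps.
destruct (td_continuous T f _ (locally_ball (T f) (mkposreal eps Heps)))
  as [N [d Hd]].
(* A ball of the uniform structure of [C] is by definition a product of real balls, hence the two
   componentwise bounds. *)
exists N, d; split; [apply cond_pos|]; intros g Hg; exact (Hd g Hg).
Qed.

Lemma closed_subspace_agree T1 T2 : closed_subspace (agree T1 T2).
Proof.
split.
- now intros u [Hu _].
- intros u v [Hu Eu] [Hv Ev]; exists (is_rschwartz_plus u v Hu Hv).
  replace (schwartz_of_real (fun x => u x + v x) (is_rschwartz_plus u v Hu Hv)) with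
    (plus (schwartz_of_real u Hu) (schwartz_of_real v Hv)).
  + now rewrite !td_plus, Eu, Ev.
  + apply schwartz_eq; intros x; apply injective_projections; simpl; ring.
- intros a u [Hu Eu]; exists (is_rschwartz_scal a u Hu).
  replace (schwartz_of_real (fun x => a * u x) (is_rschwartz_scal a u Hu)) with
    (scal (RtoC a) (schwartz_of_real u Hu)).
  + now rewrite !td_scal, Eu.
  + apply schwartz_eq; intros x; apply injective_projections; simpl; ring.
- intros u Hu H; exists Hu; set (f := schwartz_of_real u Hu).
  assert (A : forall eps, 0 < eps -> exists c : C,
    (Rabs (fst c - fst (T1 f)) < eps /\ Rabs (snd c - snd (T1 f)) < eps) /\
    (Rabs (fst c - fst (T2 f)) < eps /\ Rabs (snd c - snd (T2 f)) < eps)).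
  { intros eps Heps.
    destruct (td_approx T1 f eps Heps) as (N1 & d1 & Hd1 & H1).
    destruct (td_approx T2 f eps Heps) as (N2 & d2 & Hd2 & H2).
    assert (Hd : 0 < Rmin d1 d2) by now apply Rmin_glb_lt.
    (* One [v] serves both distributions, and their common value at [v] is close to both values at
       [u]. The half turns the non-strict bound into the strict one that a neighbourhood
       requires. *)
    destruct (H (N1 + N2)%nat (Rmin d1 d2 / 2) ltac:(lra)) as [v [[Hv Ev] Hb]].
    assert (Hs : forall k m, (k <= N1 + N2)%nat -> (m <= N1 + N2)%nat ->
      Rbar_le (seminorm k m (minus (schwartz_of_real v Hv) f)) (Rmin d1 d2 / 2)).
    { intros k m Hk Hm; apply seminorm_minus_of_real; intros x.
      eapply Rle_trans; [|apply (Hb m x Hm)].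
      apply Rmult_le_compat_r; [apply Rabs_pos|].
      apply Rle_pow; [generalize (Rabs_pos x); lra|exact Hk]. }
    assert (Hm1 := Rmin_l d1 d2); assert (Hm2 := Rmin_r d1 d2).
    exists (T1 (schwartz_of_real v Hv)); split; [apply H1|rewrite Ev; apply H2];
      intros k m Hk Hm; (eapply Rbar_le_lt_trans; [apply Hs; lia|simpl; lra]). }
  apply injective_projections; apply eq_of_common_approx; intros eps Heps;
    destruct (A eps Heps) as [c [[Hc1 Hc2] [Hc3 Hc4]]]; eexists; split; eassumption.
Qed.

Lemma tempered_distribution_eq (T1 T2 : tempered_distribution) :
  (forall f, T1 f = T2 f) -> T1 = T2.
Proof.
destruct T1 as [t1 p1 s1 c1], T2 as [t2 p2 s2 c2]; simpl; intros H.
apply functional_extensionality in H; subst t2.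
f_equal; apply proof_irrelevance.
Qed.

(** As [k! >= 1] and [1 / beta <= 1], the power [(k!) ^ (1 / beta)] is at most [k!]. *)
Lemma exp_type_fact_decay beta (phi : schwartz) : 1 <= beta -> exp_type_decay beta phi ->
  exists A, 0 < A /\ fact_decay A 0 (fun x => Re (phi x)).
Proof.
intros Hbeta (A & Cst & HA & HC & H); exists A; split; [exact HA|].
intros m; exists (Cst m); split; [apply Rlt_le, HC|]; intros k x.
assert (Hk := proj2 (seminorm_le k m phi _) (H k m) x).
eapply Rle_trans; [apply Rmult_le_compat_l|eapply Rle_trans; [exact Hk|]].
- apply Rlt_le, weight_pos.
- eapply Rle_trans; [|apply Rmax_Cmod]; apply Rmax_l.
- rewrite Rmult_assoc, Nat.add_0_r.
  apply Rmult_le_compat_l; [apply Rlt_le, HC|].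
  apply Rmult_le_compat_l; [apply pow_le; lra|].
  rewrite <- (Rpower_1 (INR (fact k))) at 2 by apply INR_fact_lt_0.
  apply Rle_Rpower.
  + apply (le_INR 1); generalize (lt_O_fact k); lia.
  + apply (Rmult_le_reg_r beta); [lra|].
    replace (1 / beta * beta) with 1 by (field; lra); lra.
Qed.

Theorem theorem6p8 (beta : R) (hbeta : 1 <= beta) (phi : schwartz)
  (hpos : forall x : R, Im (phi x) = 0 /\ 0 < Re (phi x))
  (hdecay : exp_type_decay beta phi)
  (T1 T2 : tempered_distribution)
  (hmom : forall n : nat, T1 (mul_pow n phi) = T2 (mul_pow n phi)) :
  T1 = T2.
Proof.
destruct (exp_type_fact_decay beta phi hbeta hdecay) as [A [HA Hdec]].
assert (Hall : forall u, is_rschwartz u -> agree T1 T2 u).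
{ apply (polynomial_multiples_dense (agree T1 T2) A 0 (fun x => Re (phi x)));
    [apply closed_subspace_agree|exact HA|apply hpos|exact Hdec|].
  intros n.
  assert (Hn : is_rschwartz (fun x => x ^ n * Re (phi x))).
  { destruct (proj1 (is_schwartzE _) (schwartz_prop (mul_pow n phi))) as [Hr _].
    revert Hr; apply is_rschwartz_ext; intros x; simpl; unfold Re, Im; ring. }
  exists Hn.
  replace (schwartz_of_real _ Hn) with (mul_pow n phi); [apply hmom|].
  apply schwartz_eq; intros x; destruct (hpos x) as [Him _].
  unfold Re, Im in *; apply injective_projections; simpl; rewrite Him; unfold Re; ring. }
apply tempered_distribution_eq; intros f.
destruct (proj1 (is_schwartzE f) (schwartz_prop f)) as [Hr Hi].
rewrite (schwartz_real_imag f Hr Hi), !td_plus, !td_scal.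
destruct (Hall _ Hr) as [Hr' Er], (Hall _ Hi) as [Hi' Ei].
rewrite (proof_irrelevance _ Hr Hr'), (proof_irrelevance _ Hi Hi').
now rewrite Er, Ei.
Qed.
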